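(* Let $N\ge2$ and $\Omega=B_L(0)\setminus B_l(0)\subset\mathbb{R}^N$ with $0\le l<L$. Then $h_{\mathcal N}(\Omega)<h_{rad}(\Omega)$. In particular, the minimizers of $h_{\mathcal N}(\Omega)$ are not radially symmetric.
   Context: $B_r(0)$ is the ball of radius $r$ centered at the origin, with $B_0(0)=\emptyset$. $|A|$ is Lebesgue measure and $P(\omega;\Omega):=|D\chi_\omega|(\Omega)$ is the relative perimeter (total variation of $\chi_\omega$ in the interior of $\Omega$). Define $$h_{\mathcal N}(\Omega):=\inf\Big\{\frac{P(\omega;\Omega)}{|\omega|}:\ \omega\subset\Omega,\ 0<|\omega|\le\frac{|\Omega|}{2}\Big\},$$ $$h_{rad}(\Omega):=\inf\Big\{\frac{P(D;\Omega)}{|D|}:\ D\subset\Omega\text{ is radially symmetric and }0<|D|\le\frac{|\Omega|}{2}\Big\}.$$ A minimizer is an admissible set attaining the infimum. *)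

(* Defs.v *)
From HB Require Import structures.
From mathcomp Require Import all_boot all_order all_algebra.
From mathcomp Require Import all_classical all_reals all_analysis.

Set Implicit Arguments.
Unset Strict Implicit.
Unset Printing Implicit Defensive.

Import Order.TTheory GRing.Theory Num.Theory.
Import numFieldNormedType.Exports.

Local Open Scope classical_set_scope.
Local Open Scope ring_scope.

(* The product sigma-algebra on row vectors, in the same way as the library
   does for [n.-tuple T]; for [T := R] this is the Borel sigma-algebra of R^n. *)
Section measurable_rV.
Context {d} {T : sigmaRingType d}.
Variable n : nat.

Let coor : 'I_n -> 'rV[T]_n -> T := fun i x => x ord0 i.

Let rV_set0 : g_sigma_preimage coor set0.
Proof. exact: sigma_algebra0. Qed.

Let rV_setC A : g_sigma_preimage coor A -> g_sigma_preimage coor (~` A).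
Proof. exact: sigma_algebraC. Qed.

Let rV_bigcup (F : _^nat) : (forall i, g_sigma_preimage coor (F i)) ->
  g_sigma_preimage coor (\bigcup_i (F i)).
Proof. exact: sigma_algebra_bigcup. Qed.

HB.instance Definition _ := @isMeasurable.Build (measure_tuple_display d)
  'rV[T]_n (g_sigma_preimage coor) rV_set0 rV_setC rV_bigcup.

End measurable_rV.

Lemma measurable_coor d (T : sigmaRingType d) n (i : 'I_n) :
  measurable_fun setT (fun x : 'rV[T]_n => x ord0 i).
Proof.
move=> _ Y mY; rewrite setTI; apply: sub_sigma_algebra => /=.
rewrite -bigcup_seq/=; exists i => /=; first by rewrite mem_index_enum.
by exists Y => //; rewrite setTI.
Qed.

Lemma measurable_fun_rV d1 d2 (T1 : measurableType d1) (T2 : measurableType d2)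
    n (f : T1 -> 'rV[T2]_n) :
  (forall i, measurable_fun setT (fun x => f x ord0 i)) ->
  measurable_fun setT f.
Proof.
move=> mf _ A mA; rewrite setTI.
suff : g_sigma_preimage (fun (i : 'I_n) (x : 'rV[T2]_n) => x ord0 i) `<=`
    [set B | measurable (f @^-1` B)] by exact.
apply: smallest_sub.
  split => [|B mB|F mF] /=.
  - by rewrite preimage_set0.
  - by rewrite setTD preimage_setC; exact: measurableC.
  - by rewrite preimage_bigcup; exact: bigcupT_measurable.
rewrite -bigcup_seq => B [i _ [C mC <-]] /=.
by rewrite setTI; have := mf i measurableT C mC; rewrite setTI.
Qed.

Section lebesgue_rV.
Context {R : realType}.

Definition rV_cons n (p : (measurableTypeR R * 'rV[R]_n)%type) : 'rV[R]_n.+1 :=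
  row_mx (p.1%:M : 'rV[R]_1) p.2.

Definition rV_uncons n (x : 'rV[R]_n.+1) : (measurableTypeR R * 'rV[R]_n)%type :=
  (x ord0 ord0, rsubmx (x : 'rV[R]_(1 + n))).

Lemma rV_consK n : cancel (@rV_cons n) (@rV_uncons n).
Proof.
move=> [a x]; rewrite /rV_uncons /rV_cons row_mxKr; congr (_, _) => /=.
rewrite (_ : ord0 = lshift n (ord0 : 'I_1) :> 'I_(1 + n)); last exact/val_inj.
by rewrite (@row_mxEl R 1 1 n) mxE eqxx.
Qed.

Lemma measurable_rV_cons n : measurable_fun setT (@rV_cons n).
Proof.
apply: measurable_fun_rV => i; rewrite /rV_cons.
case: (@split_ordP 1 n i) => j ->.
  under eq_fun do rewrite (@row_mxEl R 1 1 n) (ord1 j) mxE eqxx.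
  exact: measurable_fst.
under eq_fun do rewrite (@row_mxEr R 1 1 n).
exact: measurableT_comp (measurable_coor _) measurable_snd.
Qed.

Lemma measurable_rV_uncons n : measurable_fun setT (@rV_uncons n).
Proof.
apply: measurable_fun_pair; first exact: measurable_coor.
apply: measurable_fun_rV => i.
under eq_fun do rewrite mxE.
exact: measurable_coor.
Qed.

Section step.
Variables (n : nat) (mu : {sigma_finite_measure set 'rV[R]_n -> \bar R}).

Definition lebesgue_cons : set 'rV[R]_n.+1 -> \bar R :=
  pushforward (@lebesgue_measure R \x mu)%E (@rV_cons n).

Let lebesgue_cons0 : lebesgue_cons set0 = 0%E.
Proof. by rewrite /lebesgue_cons /pushforward preimage_set0 measure0. Qed.

Let lebesgue_cons_ge0 A : (0 <= lebesgue_cons A)%E.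
Proof. by rewrite /lebesgue_cons /pushforward; exact: measure_ge0. Qed.

Let lebesgue_cons_semi_sigma_additive : semi_sigma_additive lebesgue_cons.
Proof.
have mpre B : measurable B -> measurable (@rV_cons n @^-1` B).
  by move=> mB; rewrite -[X in measurable X]setTI; exact: measurable_rV_cons.
move=> F mF tF mUF; rewrite /lebesgue_cons /pushforward preimage_bigcup.
apply: measure_semi_sigma_additive.
- by move=> k; apply: mpre; exact: mF.
- apply/trivIsetP => /= i j _ _ ij; rewrite -preimage_setI.
  by move/trivIsetP : tF => /(_ _ _ _ _ ij) ->//; rewrite preimage_set0.
- by rewrite -preimage_bigcup; exact: mpre.
Qed.

HB.instance Definition _ := isMeasure.Build _ _ _ lebesgue_cons
  lebesgue_cons0 lebesgue_cons_ge0 lebesgue_cons_semi_sigma_additive.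

Let lebesgue_cons_sigma_finite : sigma_finite setT lebesgue_cons.
Proof.
have /sigma_finiteP[F [TF ndF Foo]] := sigma_finiteT (@lebesgue_measure R).
have /sigma_finiteP[G [TG ndG Goo]] := sigma_finiteT mu.
exists (fun k => @rV_uncons n @^-1` (F k `*` G k)).
  rewrite -preimage_bigcup -[LHS](preimage_setT (@rV_uncons n)).
  congr (_ @^-1` _); apply/esym; rewrite -subTset => -[a x] _.
  have [i _ Fa] : (\bigcup_i F i) a by rewrite -TF.
  have [j _ Gx] : (\bigcup_i G i) x by rewrite -TG.
  exists (maxn i j) => //; split => /=.
    by move: Fa; exact/subsetPset/ndF/leq_maxl.
  by move: Gx; exact/subsetPset/ndG/leq_maxr.
move=> k; have [mFk Fkoo] := Foo k; have [mGk Gkoo] := Goo k; split.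
  rewrite -[X in measurable X]setTI; apply: measurable_rV_uncons => //.
  exact: measurableX.
rewrite /lebesgue_cons /pushforward -comp_preimage.
rewrite (_ : _ \o _ = idfun); last by apply/funext => p; exact: rV_consK.
by rewrite preimage_id product_measure1E// lte_mul_pinfty// ge0_fin_numE.
Qed.

HB.instance Definition _ := Measure_isSigmaFinite.Build _ _ _ lebesgue_cons
  lebesgue_cons_sigma_finite.

End step.

(* Lebesgue measure on the Borel sets of R^n, as an iterated product measure. *)
Fixpoint lebesgue_rV n : {sigma_finite_measure set 'rV[R]_n -> \bar R} :=
  if n is m.+1 then lebesgue_cons (lebesgue_rV m) else \d_(0 : 'rV[R]_0).

(* Lebesgue measure on all Lebesgue measurable sets: the completion of
   [lebesgue_rV n], built like the library's [completed_lebesgue_measure]. *)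
Definition lebesgue_measurable n (A : set 'rV[R]_n) : Prop :=
  ((lebesgue_rV n)^*)%mu.-cara.-measurable A.

Definition leb n : set (caratheodory_type ((lebesgue_rV n)^*)%mu) -> \bar R :=
  @completed_measure_extension _ _ _ (lebesgue_rV n).

HB.instance Definition _ n := Measure.on (@leb n).

End lebesgue_rV.

Lemma measurable_box (R : realType) n (A : 'I_n -> set (measurableTypeR R)) :
  (forall i, measurable (A i)) ->
  measurable [set x : 'rV[R]_n | forall i, A i (x ord0 i)].
Proof.
move=> mA.
rewrite (_ : mkset _ =
    \big[setI/setT]_(i < n) ((fun x : 'rV[R]_n => x ord0 i) @^-1` A i)).
  apply: big_rec => [|i B _ mB]; first exact: measurableT.
  apply: measurableI => //; rewrite -[X in measurable X]setTI.
  by apply: measurable_coor => //; exact: mA.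
rewrite -bigcap_seq; apply/seteqP; split => [x Ax i _|x Ax i]; first exact: Ax.
by apply: Ax; rewrite /= mem_index_enum.
Qed.

Lemma lebesgue_rV_box (R : realType) n (A : 'I_n -> set (measurableTypeR R)) :
  (forall i, measurable (A i)) ->
  lebesgue_rV n [set x | forall i, A i (x ord0 i)] =
  (\prod_(i < n) lebesgue_measure (A i))%E.
Proof.
elim: n A => [A _|n IHn A mA].
  by rewrite big_ord0 /= diracE mem_set// => -[].
rewrite big_ord_recl -IHn; last by move=> i; exact: mA.
have mB : measurable [set x : 'rV[R]_n | forall i, A (lift ord0 i) (x ord0 i)].
  by apply: (@measurable_box _ _ (fun i => A (lift ord0 i))) => i; exact: mA.
rewrite -product_measure1E//.
rewrite /= /lebesgue_cons /pushforward; congr product_measure1.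
have rV0 a (x : 'rV[R]_n) : rV_cons (a, x) ord0 ord0 = a.
  by have /(congr1 fst) := rV_consK (a, x).
have rVS a (x : 'rV[R]_n) i : rV_cons (a, x) ord0 (lift ord0 i) = x ord0 i.
  rewrite (_ : lift ord0 i = rshift 1 i); last exact/val_inj.
  by rewrite /rV_cons (@row_mxEr _ 1 1 n).
apply/seteqP; split=> -[a x] /= => [Ax|[Aa Ax] i].
  by split=> [|i]; [have := Ax ord0; rewrite rV0|have := Ax (lift ord0 i); rewrite rVS].
by case: (unliftP ord0 i) => [j ->|->]; rewrite ?rV0// ?rVS.
Qed.

Lemma leb_lebesgue_rV (R : realType) n (A : set 'rV[R]_n) :
  measurable A -> leb A = lebesgue_rV n A.
Proof.
by move=> mA; rewrite /leb /completed_measure_extension measurable_mu_extE.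
Qed.

Section perimeter.
Context {R : realType} {n : nat}.
Implicit Types (x c : 'rV[R]_n) (U A omega Omega : set 'rV[R]_n).

(* The library's norm on ['rV[R]_n] is the sup norm; it induces the usual
   topology, but lengths here are Euclidean. *)
Definition enorm x : R := Num.sqrt (\sum_i x ord0 i ^+ 2).

Definition eball c (r : R) : set 'rV[R]_n := [set x | enorm (x - c) < r].

Definition partial (i : 'I_n) (f : 'rV[R]_n -> R) : 'rV[R]_n -> R :=
  'D_(delta_mx ord0 i) f.

Definition is_C1 (f : 'rV[R]_n -> R) : Prop :=
  forall i, (forall x, derivable f x (delta_mx ord0 i)) /\
            continuous (partial i f).

Definition fsupport (phi : 'rV[R]_n -> 'rV[R]_n) : set 'rV[R]_n :=
  closure [set x | phi x != 0].

(* The vector fields of class [C^1_c(U; R^n)], extended by 0 outside [U]. *)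
Definition test_field U (phi : 'rV[R]_n -> 'rV[R]_n) : Prop :=
  [/\ forall i, is_C1 (fun x => phi x ord0 i),
      compact (fsupport phi) & fsupport phi `<=` U].

Definition divergence (phi : 'rV[R]_n -> 'rV[R]_n) x : R :=
  \sum_i partial i (fun y => phi y ord0 i) x.

(* |Du|(U), for [U] open. *)
Definition variation (u : 'rV[R]_n -> R) U : \bar R :=
  ereal_sup [set (\int[@leb R n]_(x in U) (u x * divergence phi x)%:E)%E |
    phi in [set phi | test_field U phi /\ forall x, enorm (phi x) <= 1]].

Definition perimeter omega Omega : \bar R := variation \1_omega Omega°.

Definition radially_symmetric A : Prop :=
  forall x y, enorm x = enorm y -> A x -> A y.

Definition admissible Omega omega : Prop :=
  [/\ lebesgue_measurable omega, omega `<=` Omega, (0 < leb omega)%E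
     & (leb omega <= leb Omega / 2%:E)%E].

Definition cheeger_ratio Omega omega : \bar R :=
  (perimeter omega Omega / leb omega)%E.

Definition h_N Omega : \bar R :=
  ereal_inf [set cheeger_ratio Omega omega | omega in admissible Omega].

Definition h_rad Omega : \bar R :=
  ereal_inf [set cheeger_ratio Omega D |
    D in [set D | radially_symmetric D /\ admissible Omega D]].

Definition h_N_minimizer Omega omega : Prop :=
  admissible Omega omega /\ cheeger_ratio Omega omega = h_N Omega.

End perimeter.

(* Main.v *)
(* Let t = |x|^N, a = l^N, b = L^N and w_N = |B_1| in R^N.

   A half annulus {x_0 > 0} has perimeter at most w_{N-1} L^{N-1} and volume
   w_N (b - a) / 2. Since the half ball contains the cone over its equatorial
   disc, 2 w_{N-1} <= N w_N, so that h_N <= N b / ((b - a) L).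

   The push-forward of Lebesgue measure by t is w_N times Lebesgue measure on
   [0, +oo[, so a radial D is, up to a null set, {t in E} with E of length
   s = |D| / w_N <= (b - a) / 2. Both E and its complement have positive length
   beyond a + s' for every s' < s, hence density points p and q there. The field
   F(t) x / t, where F goes from 0 to (or from) the constant h between p and q,
   has divergence N F'(t), and its integral over D is close to N w_N h. It has
   norm at most 1 as soon as h <= t^{(N-1)/N} on its support, so h may be taken
   close to (a + s) / r_0 with r_0^N = (a + b) / 2. Therefore
   h_rad >= N (a + b) / ((b - a) r_0), and r_0 < L. *)
Require Import Defs.
From mathcomp Require Import all_boot all_order all_algebra.
From mathcomp Require Import all_classical all_reals all_analysis measurable_realfun.
From mathcomp Require Import ring lra.
Import Order.TTheory GRing.Theory Num.Theory.
Import numFieldNormedType.Exports.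
Local Open Scope classical_set_scope.
Local Open Scope ring_scope.
Set Implicit Arguments.
Unset Strict Implicit.
Unset Printing Implicit Defensive.

(** The perimeter stays a supremum over test fields throughout. An upper bound must therefore treat
    every field, which Fubini and the fundamental theorem of calculus do for a flat interface,
    whereas a lower bound needs one good field; this is why a radial set enters only through two
    density points. The norm of F(t) x / t is |F(t)| / t^{(N-1)/N}, whence the constraint on h. The
    linear expression (a + s) / r_0 replaces the natural value (a + s)^{(N-1)/N}: it is not larger
    as long as a + s <= r_0^N, and equality holds at s = (b - a) / 2. Nothing is lost at the extreme
    volume, and (a + s) / s is visibly nonincreasing in s. Admissible sets are measurable for the
    completed measure only, while Fubini and the push-forward by t are carried out on Borel sets;
    approximation by closed sets links the two. *)

(** * Borel sets of R^n and their approximation by closed sets *)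

Lemma countable_bigcup_measurable d (T : sigmaRingType d) (I : countType)
    (F : I -> set T) :
  (forall i, measurable (F i)) -> measurable (\bigcup_i F i).
Proof.
move=> mF.
rewrite (_ : \bigcup_i F i =
    \bigcup_n (if @unpickle I n is Some i then F i else set0)); last first.
  apply/seteqP; split => [x [i _ Fx]|x [n _]].
    by exists (pickle i) => //; rewrite pickleK.
  by case: unpickle => // i Fx; exists i.
by apply: bigcupT_measurable => n; case: unpickle.
Qed.

(** The sigma-algebra is generated by the coordinates, so an open set has to be recovered as a union
    of boxes; those with rational centre and radius [k.+1%:R^-1] form a countable family. *)
Lemma open_measurable_rV (R : realType) n (U : set 'rV[R]_n) :
  open U -> measurable U.
Proof.
move=> oU.
pose box (i : 'rV[rat]_n * nat) : set 'rV[R]_n :=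
  [set x | forall j, ball (ratr (i.1 ord0 j) : R) i.2.+1%:R^-1 (x ord0 j)].
have mbox i : measurable (box i).
  apply: (@measurable_box _ _ (fun j => ball (ratr (i.1 ord0 j) : R) i.2.+1%:R^-1)).
  by move=> j; exact: measurable_ball.
rewrite (_ : U = \bigcup_i (if `[< box i `<=` U >] then box i else set0)).
  by apply: countable_bigcup_measurable => i; case: ifP.
apply/seteqP; split => [x Ux|x [i _]]; last first.
  by case: asboolP => // + ?; apply.
have /nbhs_ballP[e /= e0 xU] := open_nbhs_nbhs (conj oU Ux).
(* A box of radius [d < e / 2] that contains [x] lies within [e] of [x]. *)
have e20 : 0 < e / 2 by rewrite divr_gt0.
have [k _ ke] := near_infty_natSinv_lt (PosNum e20).
have ke' := ke _ (leqnn k); rewrite /= in ke'.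
have k0 : (0 : R) < k.+1%:R^-1 by rewrite invr_gt0.
move dE : (k.+1%:R^-1 : R) => d in k0 ke'.
have qP j : exists q, ratr q \in `](x ord0 j - d), x ord0 j + d[.
  by apply: rat_in_itvoo; rewrite ltrBlDr -addrA ltrDl addr_gt0.
pose q : 'rV[rat]_n := \row_j sval (cid (qP j)).
have xq j : `|ratr (q ord0 j) - x ord0 j| < d.
  rewrite /q mxE; case: cid => y /=; rewrite in_itv/= => /andP[y1 y2].
  by rewrite ltr_norml; lra.
exists (q, k) => //; case: asboolP => [_ j|]; first by rewrite /= dE; exact: xq.
case=> y yb; apply: xU; split => // i j; rewrite (ord1 i) {i}.
move: (yb j) (xq j); rewrite /ball/= dE !ltr_norml; lra.
Qed.

Lemma continuous_measurable_rV (R : realType) n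
    (f : 'rV[R]_n -> R) :
  continuous f -> measurable_fun setT f.
Proof.
move=> cf; apply: (measurability _ (RGenOpens.measurableE R)) => _ [_ [a [b ->] <-]].
rewrite setTI; apply: open_measurable_rV.
apply: open_comp; last exact: interval_open.
by move=> x _; exact: cf.
Qed.

Lemma closed_measurable_rV (R : realType) n (F : set 'rV[R]_n) :
  closed F -> measurable F.
Proof.
move=> cF; rewrite -(setCK F); apply: measurableC; apply: open_measurable_rV.
exact: closed_openC.
Qed.

Lemma measure_decreasing_small d (T : measurableType d) (R : realType)
    (mu : {measure set T -> \bar R}) (F : (set T)^nat) (e : R) :
  (mu setT < +oo)%E -> (forall k, measurable (F k)) ->
  {homo F : n m / (n <= m)%N >-> (m <= n)%O} -> \bigcap_k F k = set0 ->
  0 < e -> exists k, (mu (F k) < e%:E)%E.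
Proof.
move=> muT mF dF F0 e0.
have F0oo : (mu (F 0%N) < +oo)%E.
  by rewrite (le_lt_trans _ muT)// le_measure ?inE.
have mFI : measurable (\bigcap_k F k) by rewrite F0.
have := nonincreasing_cvg_mu F0oo mF mFI dF.
rewrite F0 measure0 => /fine_cvgP[[k1 _ k1P] /cvgrPdist_lt/(_ _ e0)[k2 _ k2P]].
exists (maxn k1 k2).
have := k2P _ (leq_maxr k1 k2); have := k1P _ (leq_maxl k1 k2) => /=.
by move=> fin; rewrite distrC subr0 ger0_norm ?fine_ge0// -lte_fin fineK.
Qed.

Section closed_approximation.
Context {R : realType} {n : nat} {mu : {measure set 'rV[R]_n -> \bar R}}.
Hypothesis muT : (mu setT < +oo)%E.

(** Inner approximation of [A] and of its complement at once: the condition is symmetric under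
    complement, so that the approximable sets form a sigma-algebra and only generators remain to be
    checked. *)
Let approximable (A : set 'rV[R]_n) := forall e : R, 0 < e ->
  exists F1 F2, [/\ closed F1, closed F2, F1 `<=` A, F2 `<=` ~` A &
    (mu (~` (F1 `|` F2)) < e%:E)%E].

Let approximable0 : approximable set0.
Proof.
move=> e e0; exists set0, setT; split; [exact: closed0|exact: closedT|by []| |].
  by rewrite setC0.
by rewrite set0U setCT measure0 lte_fin.
Qed.

Let approximableC A : approximable A -> approximable (~` A).
Proof.
move=> aA e /aA[F1 [F2 [cF1 cF2 F1A F2A muF]]]; exists F2, F1; split => //.
  by rewrite setCK.
by rewrite setUC.
Qed.

(** The intersection of the closed sets outside the [A k] is closed, but the union of those inside
    need not be. It is truncated to [G k], at the price of the tail [H k], which is small by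
    continuity from above. Half of [e] pays for the tail, the other half is shared geometrically
    among the [A k]. *)
Let approximable_bigcup (A : (set 'rV[R]_n)^nat) :
  (forall k, approximable (A k)) -> approximable (\bigcup_k A k).
Proof.
move=> aA e e0.
have e20 : 0 < e / 2 by rewrite divr_gt0.
have e2n0 k : 0 < e / 2 / (2 ^ k.+1)%:R by rewrite divr_gt0.
have [F /all_and5 [cF1 cF2 F1A F2A muF]] :
    {F : nat -> set 'rV[R]_n * set 'rV[R]_n & forall k,
    [/\ closed (F k).1, closed (F k).2, (F k).1 `<=` A k, (F k).2 `<=` ~` A k &
    (mu (~` ((F k).1 `|` (F k).2)) < (e / 2 / (2 ^ k.+1)%:R)%:E)%E]}.
  apply: (@choice _ _ (fun k F => [/\ closed F.1, closed F.2, F.1 `<=` A k,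
    F.2 `<=` ~` A k & (mu (~` (F.1 `|` F.2)) < (e / 2 / (2 ^ k.+1)%:R)%:E)%E])).
  by move=> k; have [F1 [F2 ?]] := aA k _ (e2n0 k); exists (F1, F2).
pose G k := \bigcup_(i < k) (F i).1.
pose F2 := \bigcap_k (F k).2.
have cG k : closed (G k).
  rewrite /G; apply: closed_bigcup => //; exact: finite_II.
have cF2' : closed F2 by exact: closed_bigI.
have mF1 k : measurable (F k).1 by exact: closed_measurable_rV.
have mF2 k : measurable (F k).2 by exact: closed_measurable_rV.
pose H k := (\bigcup_i (F i).1) `\` G k.
have mG k : measurable (G k) by exact: closed_measurable_rV.
have mU : measurable (\bigcup_i (F i).1) by exact: bigcupT_measurable.
have mF2' : measurable F2 by exact: closed_measurable_rV.
have [k Hk] : exists k, (mu (H k) < (e / 2)%:E)%E.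
  apply: measure_decreasing_small => //.
  - by move=> k; exact: measurableD.
  - move=> i j ij; apply/subsetPset; apply: setDS => x [m /= mi Fx].
    by exists m => //=; exact: leq_trans ij.
  - apply/seteqP; split => // x Hx; have [[i _ Fx] _] := Hx 0%N Logic.I.
    by have [_] := Hx i.+1 Logic.I; apply; exists i => /=.
exists (G k), F2; split => //.
- by move=> x [i _ Fx]; exists i => //; exact: F1A.
- by move=> x F2x [i _ Ax]; exact: F2A (F2x i Logic.I) Ax.
have Hsub : ~` (G k `|` F2) `<=`
    (\bigcup_i ~` ((F i).1 `|` (F i).2)) `|` H k.
  move=> x; rewrite setCU => -[nG nF2].
  have [[i _ Fi]|nU] := pselect ((\bigcup_i (F i).1) x).
    by right; split => //; exists i.
  left; move/existsNP : nF2 => -[i /not_implyP[_ nF2]]; exists i => //.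
  by rewrite setCU; split => // ?; apply: nU; exists i.
have mV i : measurable (~` ((F i).1 `|` (F i).2)).
  by apply: measurableC; exact: measurableU.
have mW : measurable (\bigcup_i ~` ((F i).1 `|` (F i).2)).
  exact: bigcupT_measurable.
have mH i : measurable (H i) by exact: measurableD.
apply: (@le_lt_trans _ _ (mu ((\bigcup_i ~` ((F i).1 `|` (F i).2)) `|` H k))).
  rewrite le_measure ?inE//; last exact: measurableU.
  by apply: measurableC; exact: measurableU.
apply: (@le_lt_trans _ _ (mu (\bigcup_i ~` ((F i).1 `|` (F i).2)) + mu (H k))%E).
  exact: measureU2.
rewrite [e in X in (_ < X)%E]splitr EFinD lee_ltD//.
  rewrite ge0_fin_numE//; apply: le_lt_trans muT; rewrite le_measure ?inE//.
apply: (@le_trans _ _ (\sum_(i <oo) mu (~` ((F i).1 `|` (F i).2)))%E).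
  exact: measure_sigma_subadditive.
apply: (@le_trans _ _ (\sum_(i <oo) (0 + (e / 2 / (2 ^ i.+1)%:R)%:E))%E).
  by apply: lee_nneseries => // i _; rewrite add0e ltW.
by rewrite (le_trans (epsilon_trick _ _ _))// ?eseries0 ?add0e// ltW.
Qed.

(** On the generating rays [[x, +oo[] the set is already closed, and its complement is exhausted by
    the closed half-spaces at distance [k.+1%:R^-1]. *)
Let approximable_coor (i : 'I_n) (C : set (measurableTypeR R)) :
  measurable C -> approximable [set x | C (x ord0 i)].
Proof.
suff : @measurable _ (measurableTypeR R) `<=`
    [set C | approximable [set x | C (x ord0 i)]] by exact.
have -> : @measurable _ (measurableTypeR R) = <<s @RGenCInfty.G R >>.
  exact: RGenCInfty.measurableE.
apply: smallest_sub => [|_ [x ->] e e0].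
  split => [|B aB|B aB]; first exact: approximable0.
    by rewrite setTD; exact: approximableC.
  exact: approximable_bigcup.
have ci : continuous (fun y : 'rV[R]_n => y ord0 i).
  by move=> y; exact: coord_continuous.
pose F2 k := [set y : 'rV[R]_n | y ord0 i <= x - k.+1%:R^-1].
have cle c : closed [set y : 'rV[R]_n | y ord0 i <= c].
  by apply: (@closed_comp _ _ _ [set z | z <= c]) => // y _; exact: ci.
have cge c : closed [set y : 'rV[R]_n | c <= y ord0 i].
  by apply: (@closed_comp _ _ _ [set z | c <= z]) => // y _; exact: ci.
have [k Hk] : exists k, (mu (~` ([set y : 'rV[R]_n | (x <= y ord0 i)%R] `|` F2 k)) < e%:E)%E.
  apply: measure_decreasing_small => //.
  - move=> k; apply: measurableC; apply: measurableU.
      by apply: closed_measurable_rV; exact: cge.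
    by apply: closed_measurable_rV; exact: cle.
  - move=> k m km; apply/subsetPset; apply: subsetC; apply: setUS => y /=.
    move=> /le_trans; apply; rewrite lerD2l lerN2 lef_pV2 ?posrE//.
    by rewrite ler_nat.
  - apply/seteqP; split => // y yP.
    have /not_orP[/negP + _] := yP 0%N Logic.I; rewrite -ltNge -subr_gt0 => yx.
    have [k _ kP] := near_infty_natSinv_lt (PosNum yx).
    have /not_orP[_] := yP k Logic.I; apply => /=.
    by have /= := kP _ (leqnn k); rewrite ltrBrDr addrC -ltrBrDr => /ltW.
exists [set y : 'rV[R]_n | (x <= y ord0 i)%R], (F2 k); split => //.
- exact: cle.
- by move=> y /=; rewrite in_itv/= andbT.
move=> y /=; rewrite in_itv/= andbT => yx; apply/negP; rewrite -ltNge.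
by rewrite (le_lt_trans yx)// ltrBlDr ltrDl invr_gt0.
Qed.

Lemma measurable_closed_approx (A : set 'rV[R]_n) (e : R) : measurable A -> 0 < e ->
  exists F1 F2, [/\ closed F1, closed F2, F1 `<=` A, F2 `<=` ~` A &
    (mu (~` (F1 `|` F2)) < e%:E)%E].
Proof.
move=> mA; suff : approximable A by exact.
move: A mA; apply: smallest_sub.
  split => [|B aB|B aB] /=; first exact: approximable0.
    by rewrite setTD; exact: approximableC.
  exact: approximable_bigcup.
rewrite -bigcup_seq => _ [i _ [C mC <-]].
by rewrite setTI; exact: approximable_coor.
Qed.

End closed_approximation.

(** * Passage between the completed measure and the Borel measure *)

Section leb_transfer.
Context {R : realType} {n : nat}.
Implicit Types (A B : set 'rV[R]_n) (f : 'rV[R]_n -> \bar R).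
Local Notation rVc := (caratheodory_type ((@lebesgue_rV R n)^*)%mu).

Lemma sub_lebesgue_measurable A : measurable A -> lebesgue_measurable A.
Proof. by move=> mA; apply: sub_caratheodory; exact: sub_sigma_algebra. Qed.

(** The push-forward of [leb] by this identity is [lebesgue_rV] on Borel sets, which is how
    integrals change measure below. *)
Lemma measurable_idfun_leb :
  measurable_fun setT (idfun : rVc -> 'rV[R]_n).
Proof. by move=> _ A mA; rewrite setTI; exact: sub_lebesgue_measurable. Qed.

Lemma ge0_integral_leb A f : measurable A -> measurable_fun A f ->
  (forall x, A x -> 0 <= f x)%E ->
  (\int[@leb R n]_(x in A) f x = \int[lebesgue_rV n]_(x in A) f x)%E.
Proof.
move=> mA mf f0.
transitivity (\int[pushforward (@leb R n) (idfun : rVc -> 'rV[R]_n)]_(x in A) f x)%E.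
  rewrite (ge0_integral_pushforward measurable_idfun_leb)//.
  by move=> x /[!inE]; exact: f0.
apply: eq_measure_integral => [|m B mB BA]; first exact: measurable_idfun_leb.
exact: leb_lebesgue_rV.
Qed.

Lemma integral_leb A f : measurable A -> measurable_fun A f ->
  (\int[@leb R n]_(x in A) f x = \int[lebesgue_rV n]_(x in A) f x)%E.
Proof.
move=> mA mf; rewrite integralE [RHS]integralE.
congr (_ - _)%E; apply: ge0_integral_leb => //.
  exact: measurable_funepos.
exact: measurable_funeneg.
Qed.

(** The outer measure covers [V] minus [A] by a Borel set [U] with small excess; then [V] minus [U]
    is a Borel subset of [A], to which closed approximation applies. *)
Lemma lebesgue_measurable_inner A V (e : R) : lebesgue_measurable A ->
  measurable V -> A `<=` V -> (lebesgue_rV n V < +oo)%E -> 0 < e ->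
  exists F, [/\ closed F, F `<=` A & (leb (A `\` F) < e%:E)%E].
Proof.
move=> mA mV AV Voo e0.
have e20 : 0 < e / 2 by rewrite divr_gt0.
have lVoo : (leb V < +oo)%E by rewrite leb_lebesgue_rV.
have mVA : lebesgue_measurable (V `\` A).
  by apply: caratheodory_measurable_setD => //; exact: sub_lebesgue_measurable.
have VAfin : leb (V `\` A) \is a fin_num.
  rewrite ge0_fin_numE ?measure_ge0//; apply: le_lt_trans lVoo.
  by apply: le_outer_measure; exact: subDsetl.
have [_ [C [mC VAC] <-] Ce] := lb_ereal_inf_adherent e20 VAfin.
pose U := \bigcup_k C k.
have mU : measurable U by exact: bigcupT_measurable.
have Ue : (lebesgue_rV n U < leb (V `\` A) + (e / 2)%:E)%E.
  by apply: le_lt_trans Ce; exact: measure_sigma_subadditive.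
pose D := V `\` U.
have mD : measurable D by exact: measurableD.
have DA : D `<=` A.
  by move=> x [Vx nUx]; apply: contrapT => nAx; apply: nUx; exact: VAC.
(* Closed approximation is available for finite measures, whence the restriction to [V]. *)
have muT : (mrestr (lebesgue_rV n) mV setT < +oo)%E by rewrite /mrestr setTI.
have [F1 [F2 [cF1 cF2 F1D F2D muF]]] := measurable_closed_approx muT mD e20.
exists F1; split => //; first exact: subset_trans DA.
have mF1 : measurable F1 by exact: closed_measurable_rV.
have mF2 : measurable F2 by exact: closed_measurable_rV.
have AFsub : A `\` F1 `<=` (U `\` (V `\` A)) `|` (~` (F1 `|` F2) `&` V).
  move=> x [Ax nFx]; have [Ux|nUx] := pselect (U x); first by left; split => // -[].
  right; split; last exact: AV.
  by case=> // /F2D; apply; split => //; exact: AV.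
have mU' := sub_lebesgue_measurable mU.
have mF' : measurable (~` (F1 `|` F2) `&` V).
  by apply: measurableI => //; apply: measurableC; exact: measurableU.
have mF'' := sub_lebesgue_measurable mF'.
have VAU : V `\` A `<=` U by exact: VAC.
have UVA : (leb (U `\` (V `\` A)) < (e / 2)%:E)%E.
  have lU : (leb U < +oo)%E.
    by rewrite leb_lebesgue_rV// (lt_trans Ue)// ltey_eq fin_numD VAfin.
  rewrite (measureD mU' mVA lU) setIidr// lteBlDl//.
  by apply: le_lt_trans Ue; rewrite -leb_lebesgue_rV.
apply: (@le_lt_trans _ _ (leb (U `\` (V `\` A)) + leb (~` (F1 `|` F2) `&` V))%E).
  apply: le_trans (le_outer_measure _ _ _ AFsub) _.
  exact: outer_measureU2.
rewrite [e in X in (_ < X)%E]splitr EFinD lteD//.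
by rewrite leb_lebesgue_rV.
Qed.

End leb_transfer.

(** * Slices and dilations *)

Lemma lebesgue_rV_slices (R : realType) n (A : set 'rV[R]_n.+1) :
  (lebesgue_rV n.+1 A =
   \int[lebesgue_measure]_a lebesgue_rV n [set x | A (rV_cons (a, x))])%E.
Proof.
rewrite /= /lebesgue_cons /pushforward /= /product_measure1.
apply: eq_integral => a _ /=; congr (lebesgue_rV n _).
by apply/seteqP; split => x; rewrite /xsection/= inE.
Qed.

Lemma measurable_rV_cons_slice (R : realType) n (A : set 'rV[R]_n.+1) a :
  measurable A -> measurable [set x | A (rV_cons (a, x))].
Proof.
move=> mA; rewrite -[X in measurable X]setTI.
have m : measurable_fun setT (fun x : 'rV[R]_n => rV_cons (a, x)).
  by apply: (measurableT_comp (@measurable_rV_cons R n)); exact: measurable_fun_pair.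
exact: m.
Qed.

Lemma measurable_fun_slices (R : realType) n (A : set 'rV[R]_n.+1) :
  measurable A ->
  measurable_fun setT (fun a : R => lebesgue_rV n [set x | A (rV_cons (a, x))]).
Proof.
move=> mA.
have mA' : measurable ((@rV_cons R n) @^-1` A).
  by rewrite -[X in measurable X]setTI; exact: measurable_rV_cons.
rewrite (_ : (fun _ => _) = lebesgue_rV n \o xsection ((@rV_cons R n) @^-1` A)).
  exact: measurable_fun_xsection.
apply/funext => a /=; congr (lebesgue_rV n _).
by apply/seteqP; split => x; rewrite /xsection/= inE.
Qed.

(** The push-forward as a bundled measure, with the measurability proof passed explicitly. *)
Definition pushforward_measure d d' (T1 : measurableType d)
    (T2 : measurableType d') (R : realFieldType)
    (mu : {measure set T1 -> \bar R}) (f : T1 -> T2)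
    (mf : measurable_fun setT f) : {measure set T2 -> \bar R} :=
  measure_function_pushforward__canonical__measure_function_Measure mu mf.

(** The rescaled push-forward by [x -> r * x] has the right value on half-open intervals, so it is
    Lebesgue measure by uniqueness. *)
Lemma lebesgue_measure_scale (R : realType) (r : R) (A : set (measurableTypeR R)) :
  0 < r -> measurable A ->
  lebesgue_measure [set x | A (r * x)] = (r^-1%:E * lebesgue_measure A)%E.
Proof.
move=> r0 mA.
have mr : measurable_fun setT (fun x : measurableTypeR R => r * x : measurableTypeR R).
  exact: mulrl_measurable.
suff H : lebesgue_measure A = (r%:E * lebesgue_measure [set x : R | A (r * x)%R])%E.
  by rewrite H muleA -EFinM mulVf ?gt_eqF// mul1e.
transitivity (mscale (NngNum (ltW r0)) (pushforward_measure lebesgue_measure mr) A);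
  last by [].
apply: lebesgue_measure_unique => //= _ [[a b] _ <-].
rewrite /= /mscale/= /pushforward lebesgue_measure_itv/=.
rewrite (_ : _ @^-1` _ = `](r^-1 * a), (r^-1 * b)]%classic); last first.
  by apply/seteqP; split => x /=; rewrite !in_itv/= ltr_pdivrMl// ler_pdivlMl.
rewrite lebesgue_measure_itv/= !lte_fin ltr_pM2l ?invr_gt0//.
case: ifPn => _; last by rewrite mule0.
by rewrite -!EFinB -EFinM -mulrBr mulrA divff ?gt_eqF// mul1r.
Qed.

Lemma ge0_integral_scale (R : realType) (r : R) (f : R -> \bar R) :
  0 < r -> measurable_fun setT f -> (forall x, 0 <= f x)%E ->
  (\int[lebesgue_measure]_x f (r * x)%R =
   r^-1%:E * \int[lebesgue_measure]_x f x)%E.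
Proof.
move=> r0 mf f0.
have mr : measurable_fun setT (fun x : measurableTypeR R => r * x : measurableTypeR R).
  exact: mulrl_measurable.
have ri0 : 0 <= r^-1 by rewrite invr_ge0 ltW.
rewrite -(ge0_integral_mscale _ _ (NngNum ri0))//.
transitivity (\int[pushforward_measure lebesgue_measure mr]_x f x)%E.
  by rewrite [RHS](ge0_integral_pushforward mr)// preimage_setT.
apply: eq_measure_integral => A mA _.
exact: lebesgue_measure_scale.
Qed.

Lemma rV_cons0 (R : realType) n (a : R) (x : 'rV[R]_n) :
  rV_cons (a, x) ord0 ord0 = a.
Proof. by have /(congr1 fst) := rV_consK (a, x). Qed.

Lemma rV_consS (R : realType) n (a : R) (x : 'rV[R]_n) i :
  rV_cons (a, x) ord0 (lift ord0 i) = x ord0 i.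
Proof.
rewrite (_ : lift ord0 i = rshift 1 i); last exact/val_inj.
by rewrite /rV_cons (@row_mxEr _ 1 1 n).
Qed.

Lemma scale_rV_cons (R : realType) n (r a : R) (x : 'rV[R]_n) :
  r *: rV_cons (a, x) = rV_cons (r * a, r *: x).
Proof.
apply/rowP => i; rewrite mxE.
by case: (unliftP ord0 i) => [j ->|->]; rewrite ?rV_cons0 ?rV_consS// mxE.
Qed.

(** By induction each slice contributes [r ^- n], and the change of variable in the first coordinate
    one more factor [r^-1]. *)
Lemma lebesgue_rV_scale (R : realType) n (r : R) (A : set 'rV[R]_n) :
  0 < r -> measurable A ->
  lebesgue_rV n [set x | A (r *: x)] = ((r ^- n)%:E * lebesgue_rV n A)%E.
Proof.
move=> r0; elim: n A => [A mA|n IHn A mA].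
  rewrite expr0 invr1 mul1e; congr (lebesgue_rV _ _).
  by apply/seteqP; split => x /=; rewrite (_ : r *: x = x)//; apply/rowP => -[].
rewrite 2!lebesgue_rV_slices.
transitivity (\int[lebesgue_measure]_a
    ((r ^- n)%:E * lebesgue_rV n [set x | A (rV_cons ((r * a)%R, x))]))%E.
  apply: eq_integral => a _.
  rewrite -(IHn [set x | A (rV_cons (r * a, x))]); last exact: measurable_rV_cons_slice.
  congr (lebesgue_rV _ _).
  by apply/seteqP; split => x /=; rewrite scale_rV_cons.
have mf := measurable_fun_slices mA.
rewrite ge0_integralZl//; last 2 first.
- apply: (measurableT_comp mf); exact: mulrl_measurable.
- by rewrite lee_fin invr_ge0 exprn_ge0// ltW.
rewrite (@ge0_integral_scale R r (fun a => lebesgue_rV n [set x | A (rV_cons (a, x))]))//.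
by rewrite muleA -EFinM exprS invfM mulrC.
Qed.

(** * The Euclidean norm and the volume of balls *)

Definition cube (R : realType) n (M : R) : set 'rV[R]_n :=
  [set x | forall i, `[- M, M]%classic (x ord0 i)].

Section euclidean_norm.
Context {R : realType}.

Lemma measurable_cube n (M : R) :
  measurable (@cube R n M).
Proof.
by apply: (@measurable_box _ _ (fun=> `[- M, M]%classic)) => i; exact: measurable_itv.
Qed.

Lemma lebesgue_rV_cube_fin n (M : R) :
  (lebesgue_rV n (@cube R n M) < +oo)%E.
Proof.
rewrite (@lebesgue_rV_box _ _ (fun=> `[- M, M]%classic)); last first.
  by move=> i; exact: measurable_itv.
rewrite big_const_ord; elim: n => [|n IHn] /=; first exact: ltry.
rewrite lte_mul_pinfty// ?measure_ge0//.
  by rewrite lebesgue_measure_itv/=; case: ifP.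
Qed.

Lemma measurable_halfspace n :
  measurable [set x : 'rV[R]_n.+1 | 0 < x ord0 ord0].
Proof.
apply: open_measurable_rV.
apply: (@open_comp _ _ (fun y : 'rV[R]_n.+1 => y ord0 ord0) [set z | 0 < z]).
  by move=> y _; exact: coord_continuous.
exact: open_gt.
Qed.

Lemma enorm_ge0 n (x : 'rV[R]_n) : 0 <= enorm x.
Proof. exact: sqrtr_ge0. Qed.

Lemma sqr_enorm n (x : 'rV[R]_n) : enorm x ^+ 2 = \sum_i x ord0 i ^+ 2.
Proof. by rewrite sqr_sqrtr// sumr_ge0// => i _; exact: sqr_ge0. Qed.

Lemma enorm_lt_sqr n (x : 'rV[R]_n) (r : R) : 0 <= r ->
  (enorm x < r) = (enorm x ^+ 2 < r ^+ 2).
Proof. by move=> r0; rewrite ltr_sqr// nnegrE enorm_ge0. Qed.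

Lemma enormZ n (r : R) (x : 'rV[R]_n) : enorm (r *: x) = `|r| * enorm x.
Proof.
apply/eqP; rewrite -(@eqrXn2 _ 2)// ?mulr_ge0 ?enorm_ge0//.
rewrite exprMn !sqr_enorm real_normK ?num_real// mulr_sumr; apply/eqP.
by apply: eq_bigr => i _; rewrite mxE exprMn.
Qed.

Lemma sqr_enorm_cons n (a : R) (x : 'rV[R]_n) :
  enorm (rV_cons (a, x)) ^+ 2 = a ^+ 2 + enorm x ^+ 2.
Proof.
rewrite !sqr_enorm big_ord_recl rV_cons0; congr (_ + _).
by apply: eq_bigr => i _; rewrite rV_consS.
Qed.

Lemma coord_le_enorm n (x : 'rV[R]_n) i : `|x ord0 i| <= enorm x.
Proof.
rewrite -ler_sqr ?nnegrE ?enorm_ge0//.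
rewrite sqr_enorm real_normK ?num_real// (bigD1 i)//= lerDl.
by rewrite sumr_ge0// => j _; exact: sqr_ge0.
Qed.

Lemma continuous_sqr_enorm n :
  continuous (fun x : 'rV[R]_n => \sum_i x ord0 i ^+ 2).
Proof.
apply: continuous_big => [|i _ x]; first exact: add_continuous.
apply: (@continuous_comp _ _ _ (fun y : 'rV[R]_n => y ord0 i) (fun z : R => z ^+ 2)).
  exact: coord_continuous.
exact: exprn_continuous.
Qed.

Lemma continuous_enorm n : continuous (@enorm R n).
Proof.
move=> x; apply: (@continuous_comp _ _ _ (fun x : 'rV[R]_n => \sum_i x ord0 i ^+ 2)).
  exact: continuous_sqr_enorm.
exact: sqrt_continuous.
Qed.

Lemma eball0E n (r : R) : eball (0 : 'rV[R]_n) r = [set x | enorm x < r].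
Proof. by apply/seteqP; split => x; rewrite /eball/= subr0. Qed.

Lemma open_eball n (r : R) : open (eball (0 : 'rV[R]_n) r).
Proof.
rewrite eball0E; apply: (@open_comp _ _ _ [set y : R | y < r]) => [x _|].
  exact: continuous_enorm.
exact: open_lt.
Qed.

Lemma measurable_eball n (r : R) : measurable (eball (0 : 'rV[R]_n) r).
Proof. by apply: open_measurable_rV; exact: open_eball. Qed.

Definition unit_ball_volume n : R := fine (lebesgue_rV n (eball (0 : 'rV[R]_n) 1)).
Local Notation w := unit_ball_volume.

Lemma lebesgue_rV_bounded n (A : set 'rV[R]_n) (M : R) : measurable A ->
  (forall x, A x -> enorm x <= M) -> (lebesgue_rV n A < +oo)%E.
Proof.
move=> mA AM; apply: le_lt_trans (lebesgue_rV_cube_fin n M).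
apply: le_measure; rewrite ?inE//; first exact: measurable_cube.
move=> x Ax i; rewrite /= in_itv/= -ler_norml.
by rewrite (le_trans (coord_le_enorm _ _))// AM.
Qed.

Lemma lebesgue_rV_unit_ball n : lebesgue_rV n (eball (0 : 'rV[R]_n) 1) = (w n)%:E.
Proof.
rewrite fineK// ge0_fin_numE// (@lebesgue_rV_bounded _ _ 1)//.
  exact: measurable_eball.
by move=> x; rewrite eball0E => /ltW.
Qed.

Lemma unit_ball_volume_ge0 n : 0 <= w n.
Proof. by rewrite fine_ge0. Qed.

Lemma lebesgue_rV_eball n (r : R) : 0 < r ->
  lebesgue_rV n (eball (0 : 'rV[R]_n) r) = (r ^+ n * w n)%:E.
Proof.
move=> r0; rewrite EFinM -lebesgue_rV_unit_ball.
have -> : eball (0 : 'rV[R]_n) r = [set x | eball (0 : 'rV[R]_n) 1 (r^-1 *: x)].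
  apply/seteqP; split => x; rewrite !eball0E/= enormZ ger0_norm ?invr_ge0 ?ltW//;
    by rewrite ltr_pdivrMl// mulr1.
rewrite lebesgue_rV_scale ?invr_gt0//; last exact: measurable_eball.
by rewrite exprVn invrK.
Qed.

End euclidean_norm.
Arguments unit_ball_volume : clear implicits.

(** * Sets symmetric in the first coordinate, and the volume recursion *)

(** The slices at [a] and [- a] have the same measure and the slice at 0 does not count. This serves
    both for the half ball and for the half annulus. *)
Lemma lebesgue_rV_half (R : realType) n (A : set 'rV[R]_n.+1) : measurable A ->
  (forall a x, A (rV_cons (a, x)) -> A (rV_cons (- a, x))) ->
  (lebesgue_rV n.+1 (A `&` [set x | 0 < x ord0 ord0]%R) =
   \int[lebesgue_measure]_(a in `]0%R, +oo[)
     lebesgue_rV n [set x | A (rV_cons (a, x))])%E /\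
  (lebesgue_rV n.+1 A =
   2%:E * lebesgue_rV n.+1 (A `&` [set x | 0 < x ord0 ord0]%R))%E.
Proof.
move=> mA symA.
set f := fun a : R => lebesgue_rV n [set x | A (rV_cons (a, x))].
have mf : measurable_fun setT f by exact: measurable_fun_slices.
have f0 a : (0 <= f a)%E by [].
have fN a : f (- a) = f a.
  congr (lebesgue_rV n _); apply/seteqP; split => x /= /symA//; by rewrite opprK.
have E1 : (lebesgue_rV n.+1 (A `&` [set x | 0 < x ord0 ord0]%R) =
   \int[lebesgue_measure]_(a in `]0%R, +oo[) f a)%E.
  rewrite lebesgue_rV_slices [RHS]integral_mkcond; apply: eq_integral => a _.
  rewrite patchE; case: ifPn; rewrite ?inE/= ?notin_setE/= in_itv/= andbT => a0.
    congr (lebesgue_rV n _); apply/seteqP; split => x /=; rewrite rV_cons0; [by case|by []].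
  rewrite -[RHS](@measure0 _ _ _ (lebesgue_rV n)); congr (lebesgue_rV n _).
  by apply/seteqP; split => x //=; rewrite rV_cons0 => -[_ /a0].
split=> //; rewrite lebesgue_rV_slices E1 -/f.
rewrite -(setUv `]0, +oo[) ge0_integral_setU//=; last 3 first.
- exact: measurableC.
- by rewrite setUv.
- exact/disj_setPCl.
rewrite mule_natl mule2n; congr (_ + _)%E.
rewrite setCitvr; transitivity (\int[lebesgue_measure]_(a in `]-oo, 0%R]) f (- a)%R)%E.
  by apply: eq_integral => a _; rewrite fN.
by rewrite -ge0_integration_by_substitution0// integral_itv_obnd_cbnd//; exact: measurable_funTS.
Qed.

Lemma is_derive_continuous (R : realType) (f : R -> R) (x df : R) :
  is_derive x 1 f df -> {for x, continuous f}.
Proof. by case=> H _; apply: differentiable_continuous; exact/derivable1_diffP. Qed.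

Lemma integral_is_derive (R : realType) (F f : R -> R) (a b : R) : a < b ->
  (forall x : R, is_derive x 1 F (f x)) -> continuous f ->
  (\int[lebesgue_measure]_(x in `[a, b]) (f x)%:E = (F b - F a)%:E)%E.
Proof.
move=> ab dF cf.
have cF : continuous F by move=> x; exact: is_derive_continuous (dF x).
rewrite (@continuous_FTC2 _ _ F)//.
- exact: continuous_subspaceT.
- split => [x _||]; first by case: (dF x).
    by apply: cvg_at_right_filter; exact: cF.
  by apply: cvg_at_left_filter; exact: cF.
- by move=> x _; rewrite derive1E; apply: derive_val.
Qed.

(* The upper half of the unit ball contains the cone of height 1 over the
   equatorial disc. *)
Lemma unit_ball_volume_rec (R : realType) n :
  2 * unit_ball_volume R n <= n.+1%:R * unit_ball_volume R n.+1.
Proof.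
have mB := @measurable_eball R n.+1 1.
have [|E1 E2] := lebesgue_rV_half mB.
  by move=> a x; rewrite !eball0E/= !enorm_lt_sqr// !sqr_enorm_cons sqrrN.
suff H : ((unit_ball_volume R n / n.+1%:R)%:E <=
    lebesgue_rV n.+1 (eball (0 : 'rV[R]_n.+1) 1 `&` [set x | 0 < x ord0 ord0]%R))%E.
  rewrite lebesgue_rV_unit_ball in E2.
  have : (2%:E * (unit_ball_volume R n / n.+1%:R)%:E <= (unit_ball_volume R n.+1)%:E)%E.
    by rewrite E2 lee_pmul2l.
  by rewrite -EFinM lee_fin mulrA ler_pdivrMr ?ltr0n// [leRHS]mulrC.
rewrite E1.
(* The cone has at height [a] a disc of radius [1 - a], whose measure is [f a]; [F] is a primitive
   of [f]. *)
pose F (a : R) := - (unit_ball_volume R n / n.+1%:R) * (1 - a) ^+ n.+1.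
pose f (a : R) := (1 - a) ^+ n * unit_ball_volume R n.
have dF (a : R) : is_derive a 1 F (f a).
  have H := is_deriveZ (- (unit_ball_volume R n / n.+1%:R))
    (is_deriveX n.+1 (is_deriveB (is_derive_cst (1 : R) a 1) (is_derive_id a 1))).
  rewrite exprfctE in H; apply: (is_derive_eq H).
  rewrite /GRing.scale/= /f sub0r.
  by field; rewrite nat1r pnatr_eq0.
have cf : continuous f.
  have H (a : R) := is_deriveZ (unit_ball_volume R n)
    (is_deriveX n (is_deriveB (is_derive_cst (1 : R) a 1) (is_derive_id a 1))).
  have -> : f = fun a => unit_ball_volume R n * (1 - a) ^+ n.
    by apply/funext => a; rewrite mulrC.
  move=> a; move: (H a); rewrite exprfctE => Ha.
  exact: is_derive_continuous Ha.
have := integral_is_derive ltr01 dF cf.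
rewrite /F subrr subr0 expr1n mulr1 expr0n mulr0 sub0r opprK => <-.
have -> : (\int[lebesgue_measure]_(x in `[0%R, 1%R]) (f x)%:E =
    \int[lebesgue_measure]_(x in `]0%R, 1%R[) (f x)%:E)%E.
  rewrite integral_itv_bndoo//; apply/measurable_EFinP/measurable_funTS.
  exact: continuous_measurable_fun.
have mf : measurable_fun setT (EFin \o f).
  by apply/measurable_EFinP; exact: continuous_measurable_fun.
apply: (@le_trans _ _ (\int[lebesgue_measure]_(x in `]0%R, 1%R[)
  lebesgue_rV n [set y | eball (0 : 'rV[R]_n.+1) 1 (rV_cons (x, y))])%E).
  apply: ge0_le_integral => //.
  - move=> x /=; rewrite in_itv/= => /andP[x0 x1].
    by rewrite lee_fin mulr_ge0 ?unit_ball_volume_ge0// exprn_ge0// subr_ge0 ltW.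
  - exact: measurable_funTS.
  - by apply: measurable_funTS; exact: measurable_fun_slices.
  - move=> x /=; rewrite in_itv/= => /andP[x0 x1].
    rewrite -lebesgue_rV_eball ?subr_gt0//; apply: le_measure; rewrite ?inE.
    + exact: measurable_eball.
    + exact: measurable_rV_cons_slice.
    move=> y; rewrite !eball0E/= => yx.
    rewrite enorm_lt_sqr// sqr_enorm_cons expr1n.
    have := enorm_ge0 y; nra.
apply: ge0_subset_integral => //; last by apply: subset_itvl.
by apply: measurable_funTS; exact: measurable_fun_slices.
Qed.

Lemma unit_ball_volume_gt0 (R : realType) n : 0 < unit_ball_volume R n.
Proof.
elim: n => [|n IHn].
  rewrite /unit_ball_volume (_ : lebesgue_rV 0 _ = 1%E) ?ltr01//=.
  by rewrite diracE mem_set// eball0E/= /enorm big_ord0 sqrtr0.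
have := unit_ball_volume_rec R n.
by move=> /(lt_le_trans _) H; have := H _ (mulr_gt0 (ltr0n _ 2) IHn); rewrite pmulr_rgt0.
Qed.

(** * Functions with bounded support and Fubini *)

(** A bound on coordinates rather than on the norm: it passes to the slices of [f] with the same
    [M]. *)
Definition supported_in (R : realType) n (M : R) (f : 'rV[R]_n -> R) :=
  forall (x : 'rV[R]_n) i, M < `|x ord0 i| -> f x = 0.

Section compactly_supported.
Context {R : realType}.

Lemma supported_in_cube n (M : R) (f : 'rV[R]_n -> R) x : supported_in M f ->
  ~ cube M x -> f x = 0.
Proof.
move=> fM /existsNP[i]; rewrite /= in_itv/= -ler_norml => /negP; rewrite -ltNge.
exact: fM.
Qed.

Lemma integrable_supported_in n (g : 'rV[R]_n -> R) (M K : R) :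
  measurable_fun setT g -> (forall x, `|g x| <= K) -> supported_in M g ->
  (lebesgue_rV n).-integrable setT (EFin \o g).
Proof.
move=> mg gK gM.
pose C := @cube R n M.
have mC : measurable C by exact: measurable_cube.
have -> : EFin \o g = (EFin \o g) \_ C.
  apply/funext => x; rewrite patchE; case: ifPn => //; rewrite notin_setE => nC.
  by rewrite /= (supported_in_cube gM nC).
apply: (integrable_mkcond (EFin \o g) mC).1; apply: measurable_bounded_integrable => //.
- exact: lebesgue_rV_cube_fin.
- exact: measurable_funTS.
- exists K; split; rewrite ?num_real// => k Kk x _ /=.
  by rewrite (le_trans (gK x))// ltW.
Qed.

Lemma supported_in_bounded n (g : 'rV[R]_n -> R) (M : R) :
  continuous g -> supported_in M g -> exists K, forall x, `|g x| <= K.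
Proof.
move=> cg gM.
have cC : compact (@cube R n `|M|).
  apply: (@rV_compact _ _ (fun=> `[- `|M|, `|M|]%classic)) => i.
  exact: segment_compact.
have gM' : supported_in `|M| g.
  by move=> x i Mx; apply: (gM x i); apply: le_lt_trans Mx; exact: ler_norm.
have cng : continuous (fun x => `|g x|).
  by move=> x; apply: (continuous_comp (cg x)); exact: norm_continuous.
have [|c _ cP] := EVT_max_rV _ cC (continuous_subspaceT cng).
  by exists 0 => i; rewrite /= in_itv/= mxE oppr_le0 normr_ge0.
exists `|g c| => x; have [Cx|nCx] := pselect (cube `|M| x).
  by apply: cP; rewrite inE.
by rewrite (supported_in_cube gM' nCx) normr0.
Qed.

Lemma supported_in_partial n i (f : 'rV[R]_n -> R) M :
  supported_in M f -> supported_in M (partial i f).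
Proof.
move=> fM x j Mx; rewrite /partial.
rewrite (@near_eq_derive _ _ _ f (cst 0)) ?derive_cst//.
have oM : open [set y : 'rV[R]_n | M < `|y ord0 j|].
  apply: (@open_comp _ _ (fun y : 'rV[R]_n => `|y ord0 j|) [set z | M < z]).
    move=> y _; apply: (@continuous_comp _ _ _ (fun y : 'rV[R]_n => y ord0 j)).
      exact: coord_continuous.
    exact: norm_continuous.
  exact: open_gt.
have := open_nbhs_nbhs (conj oM Mx).
by apply: filterS => y /= /fM.
Qed.

Section fubini.
Context (n : nat) (g : 'rV[R]_n.+1 -> R) (M K : R).
Hypotheses (mg : measurable_fun setT g) (gK : forall x, `|g x| <= K)
  (gM : supported_in M g).

Let ig := integrable_supported_in mg gK gM.

Let mgc : measurable_fun setT (EFin \o g \o @rV_cons R n).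
Proof.
by apply: measurableT_comp; [apply/measurable_EFinP|exact: measurable_rV_cons].
Qed.

Let igc : (@lebesgue_measure R \x lebesgue_rV n)%E.-integrable setT
  (EFin \o g \o @rV_cons R n).
Proof.
apply/integrableP; split => //.
case/integrableP: ig => _; apply: le_lt_trans.
have -> : (\int[lebesgue_rV n.+1]_x `|(EFin \o g) x| =
    \int[pushforward_measure (@lebesgue_measure R \x lebesgue_rV n)%E
      (@measurable_rV_cons R n)]_x `|(EFin \o g) x|)%E.
  by apply: eq_measure_integral.
rewrite [leRHS](ge0_integral_pushforward (@measurable_rV_cons R n))//.
apply/measurable_EFinP/measurableT_comp => //.
Qed.

Let integral_cons : (\int[lebesgue_rV n.+1]_x (g x)%:E =
  \int[@lebesgue_measure R \x lebesgue_rV n]_p (EFin \o g \o @rV_cons R n) p)%E.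
Proof.
transitivity (\int[pushforward_measure (@lebesgue_measure R \x lebesgue_rV n)%E
      (@measurable_rV_cons R n)]_x (g x)%:E)%E.
  by apply: eq_measure_integral.
rewrite [LHS](integral_pushforward (@measurable_rV_cons R n))//.
exact/measurable_EFinP.
Qed.

Lemma integral_rV12 : (\int[lebesgue_rV n.+1]_x (g x)%:E =
  \int[lebesgue_measure]_a \int[lebesgue_rV n]_x (g (rV_cons (a, x)))%:E)%E.
Proof. by rewrite integral_cons -(integral12_prod_meas1 igc). Qed.

Lemma integral_rV21 : (\int[lebesgue_rV n.+1]_x (g x)%:E =
  \int[lebesgue_rV n]_x \int[lebesgue_measure]_a (g (rV_cons (a, x)))%:E)%E.
Proof. by rewrite integral_cons -(integral21_prod_meas1 igc). Qed.

Lemma measurable_integral_rV21 : measurable_fun setT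
  (fun x : 'rV[R]_n => \int[lebesgue_measure]_a (g (rV_cons (a, x)))%:E)%E.
Proof. exact: measurable_fubini_G igc. Qed.

End fubini.
End compactly_supported.

(** * Integrals of partial derivatives *)

Section directional.
Context {R : realType}.

Lemma is_derive_line n (f : 'rV[R]_n -> R) (v : 'rV[R]_n) (c : R -> 'rV[R]_n) t :
  (forall h, c (h + t) = h *: v + c t) -> derivable f (c t) v ->
  is_derive t 1 (f \o c) ('D_v f (c t)).
Proof.
move=> cE df.
have E : (fun h => h^-1 *: (((f \o c) \o shift t) (h *: (1 : R)) - (f \o c) t)) =
    (fun h => h^-1 *: ((f \o shift (c t)) (h *: v) - f (c t))).
  by apply/funext => h /=; rewrite cE -[h *: 1]/(h * 1) mulr1.
by apply: DeriveDef; rewrite /derivable /derive E.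
Qed.

Lemma partial_slice n (f : 'rV[R]_n.+1 -> R) a (x : 'rV[R]_n) j :
  (fun h => h^-1 *: ((f \o shift (rV_cons (a, x)))
    (h *: delta_mx ord0 (lift ord0 j)) - f (rV_cons (a, x)))) =
  (fun h => h^-1 *: (((fun y => f (rV_cons (a, y))) \o shift x)
    (h *: delta_mx ord0 j) - f (rV_cons (a, x)))).
Proof.
apply/funext => h /=; congr (_ *: (f _ - _)); apply/rowP => i.
rewrite [LHS]mxE [X in X + _]mxE [X in _ * X]mxE.
case: (unliftP ord0 i) => [k ->|->]; rewrite ?rV_consS ?rV_cons0 eqxx/=.
  by rewrite (inj_eq lift_inj) [RHS]mxE [in RHS]mxE [X in _ = _ * X + _]mxE eqxx.
by rewrite mulr0 add0r.
Qed.

Lemma partial_sliceE n (f : 'rV[R]_n.+1 -> R) a (x : 'rV[R]_n) j :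
  partial (lift ord0 j) f (rV_cons (a, x)) =
  partial j (fun y => f (rV_cons (a, y))) x.
Proof. by rewrite /partial /derive partial_slice. Qed.

Lemma derivable_slice n (f : 'rV[R]_n.+1 -> R) a (x : 'rV[R]_n) j :
  derivable f (rV_cons (a, x)) (delta_mx ord0 (lift ord0 j)) ->
  derivable (fun y => f (rV_cons (a, y))) x (delta_mx ord0 j).
Proof. by rewrite /derivable partial_slice. Qed.

Lemma continuous_rV n (T : topologicalType) (c : T -> 'rV[R]_n) :
  (forall i, continuous (fun t => c t ord0 i)) -> continuous c.
Proof.
move=> cc t; apply/cvg_ballP => e e0.
have H i : \forall s \near t, ball (c t ord0 i) e (c s ord0 i).
  by have /cvg_ballP/(_ _ e0) := cc i t.
have := filter_forall (nbhs_filter t) H.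
by apply: filterS => s Hs; split => // i j; rewrite (ord1 i).
Qed.

Lemma continuous_rV_cons_l n (x : 'rV[R]_n) :
  continuous (fun a : R => rV_cons (a, x)).
Proof.
apply: continuous_rV => i; case: (unliftP ord0 i) => [k ->|->].
  by under eq_fun do rewrite rV_consS; exact: cst_continuous.
by under eq_fun do rewrite rV_cons0; move=> ?; exact: cvg_id.
Qed.

Lemma continuous_rV_cons_r n (a : R) :
  continuous (fun x : 'rV[R]_n => rV_cons (a, x)).
Proof.
apply: continuous_rV => i; case: (unliftP ord0 i) => [k ->|->].
  by under eq_fun do rewrite rV_consS; move=> x; exact: coord_continuous.
by under eq_fun do rewrite rV_cons0; exact: cst_continuous.
Qed.

Section first_partial.
Context (n : nat) (f : 'rV[R]_n.+1 -> R) (M : R).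
Hypotheses (df : forall x, derivable f x (delta_mx ord0 ord0))
  (cf : continuous (partial ord0 f)) (fM : supported_in M f).

Lemma integral_first_partial (b c : R) (x : 'rV[R]_n) : b < c ->
  (\int[lebesgue_measure]_(a in `[b, c]) (partial ord0 f (rV_cons (a, x)))%:E =
   (f (rV_cons (c, x)) - f (rV_cons (b, x)))%:E)%E.
Proof.
move=> bc.
have dF (t : R) : is_derive t 1 (fun a : R => f (rV_cons (a, x)))
    (partial ord0 f (rV_cons (t, x))).
  apply: (@is_derive_line _ f _ (fun a => rV_cons (a, x))) => // h.
  apply/rowP => i; rewrite [RHS]mxE [X in _ = X + _]mxE [X in _ = _ * X + _]mxE.
  case: (unliftP ord0 i) => [k ->|->]; rewrite ?rV_consS ?rV_cons0 ?eqxx/=.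
    by rewrite mulr0 add0r.
  by rewrite mulr1.
apply: (integral_is_derive bc dF) => t.
apply: (@continuous_comp _ _ _ (fun a => rV_cons (a, x)) (partial ord0 f)).
  exact: continuous_rV_cons_l.
exact: cf.
Qed.

Lemma integral_first_partial_pos (x : 'rV[R]_n) : 0 <= M ->
  (\int[lebesgue_measure]_a
     (\1_(`]0%R, +oo[%classic : set R) a * partial ord0 f (rV_cons (a, x)))%:E =
   (- f (rV_cons (0%R, x)))%:E)%E.
Proof.
(* [supported_in] gives zero only where a coordinate strictly exceeds [M], hence the endpoint
   [M + 1]. *)
move=> M0; have M1 : 0 < M + 1 by rewrite ltr_wpDl.
have := integral_first_partial x M1.
rewrite (fM (x := rV_cons (M + 1, x)) (i := ord0)); last first.
  by rewrite rV_cons0 ger0_norm ?ltrDl// ltW.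
rewrite sub0r => <-.
rewrite -integral_itv_obnd_cbnd; last first.
  apply/measurable_EFinP/measurable_funTS; apply: continuous_measurable_fun => t.
  apply: (@continuous_comp _ _ _ (fun a => rV_cons (a, x)) (partial ord0 f)).
    exact: continuous_rV_cons_l.
  exact: cf.
rewrite [RHS]integral_mkcond; apply: eq_integral => a _; rewrite patchE indicE.
have [aM|aM] := leP a (M + 1).
  by rewrite !mem_setE !in_itv/= aM !andbT; case: ifP; rewrite ?mul1r ?mul0r.
rewrite (supported_in_partial ord0 fM (i := ord0)) ?mulr0; first by case: ifP.
by rewrite rV_cons0 ger0_norm; lra.
Qed.

Lemma integral_first_partial_total (x : 'rV[R]_n) : 0 <= M ->
  (\int[lebesgue_measure]_a (partial ord0 f (rV_cons (a, x)))%:E = 0%:E)%E.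
Proof.
move=> M0; have M1 : - (M + 1) < M + 1 by lra.
have := integral_first_partial x M1.
rewrite (fM (x := rV_cons (M + 1, x)) (i := ord0)); last first.
  by rewrite rV_cons0 ger0_norm ?ltrDl// addr_ge0.
rewrite (fM (x := rV_cons (- (M + 1), x)) (i := ord0)); last first.
  by rewrite rV_cons0 normrN ger0_norm ?ltrDl// addr_ge0.
rewrite subrr => <-.
rewrite [RHS]integral_mkcond; apply: eq_integral => a _; rewrite patchE.
case: ifPn => //; rewrite mem_setE in_itv/= -ler_norml -ltNge => aM.
rewrite (supported_in_partial ord0 fM (i := ord0))// rV_cons0 (lt_trans _ aM)//.
by rewrite ltrDl.
Qed.

End first_partial.

(** For the first coordinate, Fubini integrates along the direction of the derivative, where the
    fundamental theorem gives 0. Any other partial derivative is one of the slice at fixed [a], in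
    one dimension less. *)
Lemma integral_partial_eq0 n (f : 'rV[R]_n -> R) M i : 0 <= M ->
  (forall x, derivable f x (delta_mx ord0 i)) -> continuous (partial i f) ->
  supported_in M f -> (\int[lebesgue_rV n]_x (partial i f x)%:E = 0)%E.
Proof.
move=> M0; elim: n f i => [f []//|n IHn f i df cf fM].
have [K fK] := supported_in_bounded cf (supported_in_partial i fM).
have mf := continuous_measurable_rV cf.
case: (unliftP ord0 i) => [j|] ij; rewrite ij in df cf mf fK *.
  rewrite (integral_rV12 mf fK (supported_in_partial _ fM)).
  apply: integral0_eq => a _.
  under eq_integral do rewrite partial_sliceE.
  apply: IHn => [x||x k Mx].
  - exact: derivable_slice.
  - rewrite (_ : partial j _ = fun x => partial (lift ord0 j) f (rV_cons (a, x))).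
      move=> x.
    apply: (@continuous_comp _ _ _ (fun x => rV_cons (a, x)) (partial (lift ord0 j) f)).
        exact: continuous_rV_cons_r.
      exact: cf.
    by apply/funext => x; rewrite partial_sliceE.
  - by apply: (fM _ (lift ord0 k)); rewrite rV_consS.
rewrite (integral_rV21 mf fK (supported_in_partial _ fM)).
by apply: integral0_eq => x _; apply: (integral_first_partial_total df cf fM).
Qed.
End directional.

(** * Test fields, and the perimeter of a half-space in a ball *)

Section test_fields.
Context {R : realType} {n : nat}.
Implicit Types (U : set 'rV[R]_n) (phi : 'rV[R]_n -> 'rV[R]_n).

Lemma fsupport_outside phi x : ~ fsupport phi x -> phi x = 0.
Proof.
move=> nx; apply/eqP; apply: contrapT => /negP phix; apply: nx.
exact: subset_closure.
Qed.

Lemma partial_outside phi x i : ~ fsupport phi x ->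
  partial i (fun y => phi y ord0 i) x = 0.
Proof.
move=> nx; rewrite /partial (@near_eq_derive _ _ _ _ (cst 0)) ?derive_cst//.
have oS : open (~` fsupport phi) by apply: closed_openC; exact: closed_closure.
have := open_nbhs_nbhs (conj oS nx).
by apply: filterS => y /= /fsupport_outside ->; rewrite mxE.
Qed.

Lemma divergence_outside U phi x : test_field U phi -> ~ U x ->
  divergence phi x = 0.
Proof.
move=> [_ _ supU] nU; rewrite /divergence big1// => i _.
by apply: partial_outside => /supU.
Qed.

Lemma test_field_supported_in U phi (L : R) i : test_field U phi ->
  U `<=` eball 0 L -> supported_in L (fun x => phi x ord0 i).
Proof.
move=> [_ _ supU] UL x j Lx; rewrite fsupport_outside ?mxE// => /supU/UL.
rewrite eball0E/= => xL.
by have := lt_le_trans Lx (coord_le_enorm x j); rewrite ltNge (ltW xL).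
Qed.

Lemma measurable_divergence U phi : test_field U phi ->
  measurable_fun setT (divergence phi).
Proof.
move=> [C1 _ _]; apply: measurable_sum => i.
by apply: continuous_measurable_rV; have [_ ] := C1 i i.
Qed.

(** Brings the integral that defines [variation] to the Borel measure on the whole space, where
    Fubini is available. *)
Lemma integral_test_field U phi (A : set 'rV[R]_n) : open U ->
  test_field U phi -> measurable A ->
  (\int[@leb R n]_(x in U) (\1_A x * divergence phi x)%:E =
   \int[lebesgue_rV n]_x (\1_A x * divergence phi x)%:E)%E.
Proof.
move=> oU tphi mA.
have mU : measurable U by exact: open_measurable_rV.
have mf : measurable_fun setT (fun x => \1_A x * divergence phi x).
  by apply: measurable_funM => //; exact: measurable_divergence tphi.
rewrite integral_leb//; last exact/measurable_EFinP/measurable_funTS.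
rewrite [LHS]integral_mkcond; apply: eq_integral => x _; rewrite patchE.
case: ifPn => //; rewrite notin_setE => nU.
by rewrite (divergence_outside tphi nU) mulr0.
Qed.

End test_fields.

(** The divergence theorem done by hand. On each slice at height [a] the tangential derivatives
    integrate to 0; the normal one leaves minus the trace of the first component on the hyperplane,
    which is at most 1 and lives on the disc of radius [L]. For the annulus, the hole in this disc
    is simply filled. *)
Lemma variation_halfspace_le (R : realType) n (L : R) (U H : set 'rV[R]_n.+1) :
  0 < L -> open U -> U `<=` eball 0 L ->
  (forall x, U x -> H x <-> 0 < x ord0 ord0) ->
  (Defs.variation \1_H U <= (L ^+ n * unit_ball_volume R n)%:E)%E.
Proof.
move=> L0 oU UL HU; apply: ge_ereal_sup => _ [phi [tphi phi1] <-].
pose P := [set x : 'rV[R]_n.+1 | 0 < x ord0 ord0].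
have mP : measurable P by exact: measurable_halfspace.
have -> : (\int[leb (n:=n.+1)]_(x in U) (\1_H x * divergence phi x)%:E =
    \int[leb (n:=n.+1)]_(x in U) (\1_P x * divergence phi x)%:E)%E.
  apply: eq_integral => x; rewrite inE => Ux; congr (_ * _)%:E.
  by rewrite !indicE; congr (nat_of_bool _)%:R; apply/idP/idP; rewrite !inE => /(HU _ Ux).
rewrite integral_test_field//.
pose g i x := \1_P x * partial i (fun y => phi y ord0 i) x.
have [C1 _ _] := tphi.
have sphi i := test_field_supported_in i tphi UL.
have sg i : supported_in L (g i).
  by move=> x j Lx; rewrite /g (supported_in_partial i (sphi i) Lx) mulr0.
have mg i : measurable_fun setT (g i).
  apply: measurable_funM => //.
  by apply: continuous_measurable_rV; have [_ ] := C1 i i.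
have [K gK] : {K : 'I_n.+1 -> R & forall i x, `|g i x| <= K i}.
  apply: (@choice _ _ (fun i k => forall x, `|g i x| <= k)) => i.
  have [K HK] := supported_in_bounded (C1 i i).2 (supported_in_partial i (sphi i)).
  exists K => x; rewrite /g normrM; apply: le_trans (HK x).
  by rewrite ler_piMl// indicE; case: (_ \in _); rewrite ?normr1 ?normr0.
have ig i := integrable_supported_in (mg i) (gK i) (sg i).
under eq_integral do rewrite /divergence mulr_sumr -sumEFin.
rewrite (integral_sum measurableT ig) big_ord_recl/= big1 ?adde0; last first.
  move=> i _; rewrite (integral_rV12 (mg _) (gK _) (sg _)).
  apply: integral0_eq => a _.
  have [a0|a0] := ltP 0 a; last first.
    apply: integral0_eq => x _; rewrite /g indicE memNset ?mul0r// /P/= rV_cons0.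
    by apply/negP; rewrite -leNgt.
  transitivity (\int[lebesgue_rV n]_x
      (partial i (fun y => phi (rV_cons (a, y)) ord0 (lift ord0 i)) x)%:E)%E.
    apply: eq_integral => x _; rewrite /g partial_sliceE indicE mem_set ?mul1r//.
    by rewrite /P/= rV_cons0.
  have [dphi cphi] := C1 (lift ord0 i) (lift ord0 i).
  apply: (@integral_partial_eq0 _ _ _ L) => [|x||x j Lx]; first exact: ltW.
  - exact: (@derivable_slice _ _ (fun y => phi y ord0 (lift ord0 i))).
  - rewrite (_ : partial i _ = fun x =>
      partial (lift ord0 i) (fun y => phi y ord0 (lift ord0 i)) (rV_cons (a, x))).
      move=> x; apply: (@continuous_comp _ _ _ (fun x => rV_cons (a, x))
        (partial (lift ord0 i) (fun y => phi y ord0 (lift ord0 i)))).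
        exact: continuous_rV_cons_r.
      exact: cphi.
    by apply/funext => x; rewrite partial_sliceE.
  - by apply: (sphi (lift ord0 i) _ (lift ord0 j)); rewrite rV_consS.
rewrite (integral_rV21 (mg _) (gK _) (sg _)).
have [dphi cphi] := C1 ord0 ord0.
have E x : (\int[lebesgue_measure]_a (g ord0 (rV_cons (a, x)))%:E =
    (- phi (rV_cons (0%R, x)) ord0 ord0)%:E)%E.
  rewrite -(integral_first_partial_pos dphi cphi (sphi ord0) x (ltW L0)).
  apply: eq_integral => a _; rewrite /g !indicE; congr ((nat_of_bool _)%:R * _)%:E.
  by apply/idP/idP; rewrite !inE /P/= rV_cons0 in_itv/= andbT.
have sphi0 : supported_in L (fun x : 'rV[R]_n => - phi (rV_cons (0, x)) ord0 ord0).
  by move=> x j Lx; rewrite (sphi ord0 _ (lift ord0 j)) ?oppr0// rV_consS.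
have phi_le1 x i : `|phi x ord0 i| <= 1 by apply: le_trans (phi1 x); exact: coord_le_enorm.
(* [is_C1] asserts continuity of the partial derivatives only; the trace is measurable because it is
   an inner integral in Fubini's theorem. *)
have mphi0 : measurable_fun setT (fun x : 'rV[R]_n => - phi (rV_cons (0, x)) ord0 ord0).
  apply/measurable_EFinP; rewrite (_ : _ \o _ = fun x : 'rV[R]_n =>
    \int[lebesgue_measure]_a (g ord0 (rV_cons (a, x)))%:E)%E.
    exact: measurable_integral_rV21 (mg _) (gK _) (sg _).
  by apply/funext => x; rewrite E.
under eq_integral do rewrite E.
have mB : measurable (eball (0 : 'rV[R]_n) L) by exact: measurable_eball.
rewrite -lebesgue_rV_eball// -(setIT (eball _ _)) -integral_indic//.
apply: le_integral => //.
- apply: (@integrable_supported_in _ _ _ L 1) => // x.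
  by rewrite normrN.
- apply: (@integrable_supported_in _ _ \1_(eball 0 L) L 1) => // [x|x j Lx].
    by rewrite indicE; case: (_ \in _); rewrite ?normr1 ?normr0.
  rewrite indicE memNset// eball0E/= => xL.
  by have := lt_le_trans Lx (coord_le_enorm x j); rewrite ltNge (ltW xL).
- move=> x _; rewrite lee_fin indicE; case: (boolP (x \in _)) => [_|].
    by rewrite (le_trans (ler_norm _))// normrN.
  rewrite notin_setE => nB.
  rewrite fsupport_outside ?mxE ?oppr0// => supx.
  have [_ _ supU] := tphi; apply: nB; have := UL _ (supU _ supx).
  by rewrite !eball0E/= !enorm_lt_sqr ?ltW// sqr_enorm_cons expr0n add0r.
Qed.

(** * The upper bound, from the half annulus *)

Section annulus.
Context {R : realType} (n : nat) (l L : R).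
Hypotheses (l0 : 0 <= l) (lL : l < L).
Local Notation N := n.+1.
Local Notation w := (unit_ball_volume R N).
Let Omega : set 'rV[R]_N := eball 0 L `\` eball 0 l.
Let L0 : 0 < L := le_lt_trans l0 lL.

Lemma measurable_annulus : measurable Omega.
Proof. by apply: measurableD; exact: measurable_eball. Qed.

Lemma annulus_width_gt0 : 0 < L ^+ N - l ^+ N.
Proof. by rewrite subr_gt0 ltrXn2r// nnegrE ltW. Qed.

Lemma lebesgue_rV_annulus : lebesgue_rV N Omega = (w * (L ^+ N - l ^+ N))%:E.
Proof.
transitivity (lebesgue_rV N (eball (0 : 'rV[R]_N) L) -
    lebesgue_rV N (eball (0 : 'rV[R]_N) l))%E.
  have lL' : (lebesgue_rV N (eball (0 : 'rV[R]_N) L) < +oo)%E.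
    by rewrite lebesgue_rV_eball// ltry.
  rewrite -[X in (_ - lebesgue_rV N X)%E](setIidr (A := eball (0 : 'rV[R]_N) L)).
    exact: (measureD (measurable_eball _) (measurable_eball _) lL').
  by move=> x; rewrite !eball0E/= => /lt_trans; exact.
rewrite lebesgue_rV_eball//.
(* The volume formula for balls is stated for positive radii; for [l = 0] the removed ball is
   empty. *)
have [l0'|] := ltP 0 l; first by rewrite lebesgue_rV_eball// -EFinB -mulrBl mulrC.
move=> l0'; have -> : l = 0 by apply/eqP; rewrite eq_le l0 l0'.
rewrite (_ : eball 0 0 = set0); last first.
  by apply/seteqP; split => x //; rewrite eball0E/= ltNge enorm_ge0.
by rewrite measure0 sube0 expr0n subr0 mulrC.
Qed.

Lemma leb_annulus : leb Omega = (w * (L ^+ N - l ^+ N))%:E.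
Proof. by rewrite leb_lebesgue_rV ?lebesgue_rV_annulus//; exact: measurable_annulus. Qed.

Lemma leb_annulus_half :
  (leb Omega / 2%:E = (w * (L ^+ N - l ^+ N) / 2)%:E)%E.
Proof. by rewrite leb_annulus inver pnatr_eq0/= -EFinM. Qed.

Lemma h_N_annulus_le : (h_N Omega <= (N%:R * L ^+ n / (L ^+ N - l ^+ N))%:E)%E.
Proof.
have d0 := annulus_width_gt0; have w0 := unit_ball_volume_gt0 R N.
have mO := measurable_annulus.
have [|_ E] := lebesgue_rV_half mO.
  move=> a x [xL xl]; split; [move: xL|move=> xl'; apply: xl; move: xl'];
    by rewrite !eball0E/= !enorm_lt_sqr ?(ltW L0)// !sqr_enorm_cons sqrrN.
set H := Omega `&` [set x | 0 < x ord0 ord0] in E *.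
have mH : measurable H by apply: measurableI => //; exact: measurable_halfspace.
have lH : leb H = (w * (L ^+ N - l ^+ N) / 2)%:E.
  rewrite leb_lebesgue_rV//; move: E; rewrite lebesgue_rV_annulus => E.
  have Hfin : lebesgue_rV N H \is a fin_num.
    rewrite ge0_fin_numE// (@le_lt_trans _ _ (lebesgue_rV N Omega))//.
      by apply: le_measure; rewrite ?inE//; exact: subIsetl.
    by rewrite lebesgue_rV_annulus ltry.
  move: E; rewrite -(fineK Hfin) -EFinM => -[->]; congr (_%:E).
  by rewrite mulrAC divff ?pnatr_eq0// mul1r.
have aH : admissible Omega H.
  split; [exact: sub_lebesgue_measurable|exact: subIsetl| |].
    by rewrite lH lte_fin divr_gt0// mulr_gt0.
  by rewrite leb_annulus_half lH.
apply: (@le_trans _ _ (cheeger_ratio Omega H)).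
  by apply: ereal_inf_lbound; exists H.
rewrite /cheeger_ratio lH inver gt_eqF ?divr_gt0 ?mulr_gt0//.
have := @variation_halfspace_le R n L Omega° H L0 (@open_interior _ _).
move=> /(_ _ _)/wrap[].
- by move=> x /interior_subset[].
- by move=> x /interior_subset Ox; split => [[]|]//; split.
rewrite -/(perimeter H Omega) => perH.
apply: (@le_trans _ _ ((L ^+ n * unit_ball_volume R n)%:E * (w * (L ^+ N - l ^+ N) / 2)^-1%:E)%E).
  by rewrite lee_wpmul2r// lee_fin invr_ge0 divr_ge0// mulr_ge0// ltW.
rewrite -EFinM lee_fin.
have := unit_ball_volume_rec R n.
set v := unit_ball_volume R n; set d := L ^+ N - l ^+ N in d0 *.
move=> vw; rewrite invf_div mulrA ler_pdivrMr ?mulr_gt0//.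
(* What is left is [2 * v <= N%:R * w], the cone inequality [vw]. *)
rewrite [leRHS](_ : _ = L ^+ n * (N%:R * w)); last by field; rewrite gt_eqF.
by rewrite -mulrA ler_wpM2l ?exprn_ge0 ?(ltW L0)// mulrC.
Qed.

End annulus.

(** * The push-forward by t and the profile of a radial set *)

Section radial.
Context {R : realType} (n : nat).
Local Notation N := n.+1.
Local Notation w := (unit_ball_volume R N).
Local Notation t := (fun x : 'rV[R]_N => enorm x ^+ N).

Lemma continuous_radial : continuous t.
Proof.
move=> x; apply: (@continuous_comp _ _ _ (@enorm R N) (fun z : R => z ^+ N)).
  exact: continuous_enorm.
exact: exprn_continuous.
Qed.

Lemma measurable_radial : measurable_fun setT (t : 'rV[R]_N -> measurableTypeR R).
Proof. exact: continuous_measurable_rV continuous_radial. Qed.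

Lemma measurable_radial_preimage (B : set (measurableTypeR R)) : measurable B ->
  measurable [set x : 'rV[R]_N | B (enorm x ^+ N)].
Proof. by move=> mB; rewrite -[X in measurable X]setTI; exact: measurable_radial. Qed.

Lemma lebesgue_rV_radial_lt (c : R) : 0 < c ->
  lebesgue_rV N [set x | enorm x ^+ N < c] = (c * w)%:E.
Proof.
move=> c0; pose r := c `^ (N%:R^-1).
have r0 : 0 < r by exact: powR_gt0.
have rN : r ^+ N = c.
  by rewrite -powR_mulrn ?ltW// -powRrM mulVf ?pnatr_eq0// powRr1// ltW.
rewrite -[in RHS]rN -lebesgue_rV_eball//; congr (lebesgue_rV N _).
have E (x : 'rV[R]_N) : (enorm x ^+ N < c) = (enorm x < r).
  by rewrite -[in LHS]rN ltr_pXn2r ?nnegrE ?enorm_ge0 ?ltW.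
by rewrite eball0E; apply/seteqP; split => x /=; rewrite E.
Qed.

(** The closed sublevel is squeezed between open ones, which amounts to spheres being null. The
    maximum with 0 accounts for negative [b], where the sublevel is empty. *)
Lemma lebesgue_rV_radial_le (b : R) :
  lebesgue_rV N [set x | enorm x ^+ N <= b] = (Num.max b 0 * w)%:E.
Proof.
have w0 := unit_ball_volume_gt0 R N.
have mle c : measurable [set x : 'rV[R]_N | enorm x ^+ N <= c].
  apply: (@measurable_radial_preimage [set y | y <= c]).
  by rewrite -set_itvNyc; exact: measurable_itv.
have mlt c : measurable [set x : 'rV[R]_N | enorm x ^+ N < c].
  apply: (@measurable_radial_preimage [set y | y < c]).
  by rewrite -set_itvNyo; exact: measurable_itv.
have [b0|b0] := ltP b 0.
  rewrite mul0r (_ : mkset _ = set0) ?measure0//.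
  apply/seteqP; split => x //=; apply/negP; rewrite -ltNge.
  by rewrite (lt_le_trans b0)// exprn_ge0// enorm_ge0.
apply/eqP; rewrite eq_le; apply/andP; split.
  apply/lee_addgt0Pr => e e0.
  have be0 : 0 < b + e / w by rewrite ltr_wpDl// divr_gt0.
  have -> : ((b * w)%:E + e%:E = ((b + e / w) * w)%:E)%E.
    by rewrite -EFinD mulrDl divfK ?gt_eqF.
  rewrite -lebesgue_rV_radial_lt//; apply: le_measure; rewrite ?inE//.
  by move=> x /= /le_lt_trans; apply; rewrite ltrDl divr_gt0.
move: b0; rewrite le0r => /orP[/eqP ->|b0]; first by rewrite mul0r.
rewrite -lebesgue_rV_radial_lt//; apply: le_measure; rewrite ?inE//.
by move=> x /= /ltW.
Qed.

Lemma lebesgue_rV_radial_itv (a b : R) : a <= b ->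
  lebesgue_rV N [set x | `]a, b]%classic (enorm x ^+ N)] =
  ((Num.max b 0 - Num.max a 0) * w)%:E.
Proof.
move=> ab; pose S c := [set x : 'rV[R]_N | enorm x ^+ N <= c].
have mS c : measurable (S c).
  apply: (@measurable_radial_preimage [set y | y <= c]).
  by rewrite -set_itvNyc; exact: measurable_itv.
have Sfin : (lebesgue_rV N (S b) < +oo)%E by rewrite lebesgue_rV_radial_le ltry.
have -> : [set x : 'rV[R]_N | `]a, b]%classic (enorm x ^+ N)] = S b `\` S a.
  apply/seteqP; split => x; rewrite /S/= in_itv/=.
    by move=> /andP[ax xb]; split => //; apply/negP; rewrite -ltNge.
  by move=> [xb /negP]; rewrite -ltNge => ->.
have SaSb : S a `<=` S b by move=> x /= /le_trans; exact.
transitivity (lebesgue_rV N (S b) - lebesgue_rV N (S a))%E.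
  rewrite -[X in (_ - lebesgue_rV N X)%E](setIidr SaSb).
  exact: (measureD (mS b) (mS a) Sfin).
by rewrite !lebesgue_rV_radial_le -EFinB mulrBl.
Qed.

(* The push-forward is completed by Lebesgue measure on the negative half-line
   in order to apply the uniqueness of Lebesgue measure on the whole line. *)
Lemma lebesgue_rV_radial (B : set (measurableTypeR R)) : measurable B ->
  (forall y, B y -> 0 <= y) ->
  lebesgue_rV N [set x | B (enorm x ^+ N)] = (w%:E * lebesgue_measure B)%E.
Proof.
move=> mB B0; have w0 := unit_ball_volume_gt0 R N.
have wi0 : 0 <= w^-1 by rewrite invr_ge0 ltW.
have mneg : measurable (`]-oo, 0[ : set (measurableTypeR R)) by exact: measurable_itv.
pose m1 := pushforward_measure (lebesgue_rV N) measurable_radial.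
pose m := measure_add (mscale (NngNum wi0) m1)
  (mrestr (@lebesgue_measure R) mneg).
suff H : lebesgue_measure B = m B.
  rewrite H /m/= /measure_add /msum/= big_ord_recl big_ord1/= /mscale/= /mrestr.
  rewrite (_ : B `&` `]-oo, 0[ = set0) ?measure0 ?adde0; last first.
    by apply/seteqP; split => y //= [/B0 By]; rewrite in_itv/= ltNge By.
  by rewrite muleA -EFinM divff ?gt_eqF// mul1e.
apply: lebesgue_measure_unique => // _ [[a b] _ <-] /=.
rewrite /m/= /measure_add /msum/= big_ord_recl big_ord1/= /mscale/= /mrestr.
rewrite -[X in (_ * X)%E]/(lebesgue_rV N [set x | `]a, b]%classic (enorm x ^+ N)]).
have [ab|ba] := leP b a.
  rewrite set_itv_ge ?bnd_simp -?leNgt// set0I measure0 adde0.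
  rewrite (_ : mkset _ = set0) ?measure0 ?mule0//.
rewrite lebesgue_rV_radial_itv ?ltW// lebesgue_measure_itv/= lte_fin ba -EFinM.
rewrite mulrCA mulVf ?gt_eqF// mulr1.
have [b0|b0] := ltP b 0.
  rewrite max_r ?(ltW (lt_trans ba b0))// subrr add0e setIidl.
    by rewrite lebesgue_measure_itv/= lte_fin ba.
  by move=> x /=; rewrite !in_itv/= => /andP[_ /le_lt_trans]; apply.
have [a0|a0] := ltP a 0.
  rewrite (_ : _ `&` _ = `]a, 0[%classic).
    by rewrite lebesgue_measure_itv/= lte_fin a0 -!EFinB -EFinD subr0 sub0r.
  apply/seteqP; split => x /=; rewrite !in_itv/=.
    by move=> [/andP[-> _] ->].
  by move=> /andP[-> x0]; rewrite x0 (le_trans (ltW x0)).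
rewrite (_ : _ `&` _ = set0) ?measure0 ?adde0//.
apply/seteqP; split => x //=; rewrite !in_itv/= => -[/andP[ax _]].
by rewrite ltNge (le_trans a0 (ltW ax)).
Qed.

Lemma ge0_integral_radial (B : set R) (f : R -> R) : measurable B ->
  (forall y, B y -> 0 <= y) -> measurable_fun setT f -> (forall y, 0 <= f y) ->
  (\int[lebesgue_rV N]_(x in [set x | B (enorm x ^+ N)%R]) (f (enorm x ^+ N)%R)%:E =
   w%:E * \int[lebesgue_measure]_(y in B) (f y)%:E)%E.
Proof.
move=> mB B0 mf f0; have w0 := unit_ball_volume_gt0 R N.
have mfB : measurable_fun (B : set (measurableTypeR R)) (EFin \o f).
  exact/measurable_EFinP/measurable_funTS.
transitivity (\int[pushforward_measure (lebesgue_rV N) measurable_radial]_(y in B) (f y)%:E)%E.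
  rewrite [RHS](ge0_integral_pushforward measurable_radial)//.
  by move=> y _; rewrite lee_fin.
rewrite -(ge0_integral_mscale _ _ (NngNum (ltW w0)))//.
  apply: eq_measure_integral => A mA AB; apply: lebesgue_rV_radial => // y Ay.
  exact/B0/AB.
by move=> y _; rewrite lee_fin.
Qed.

Lemma normr_le_enorm (x : 'rV[R]_N) : `|x| <= enorm x.
Proof.
rewrite [leLHS]/Num.Def.normr /= mx_normrE; apply/bigmax_leP; split => [|[i j] _ /=].
  exact: enorm_ge0.
by rewrite (ord1 i) coord_le_enorm.
Qed.

(* The image of D under the radial map need not be measurable, but the images of
   compact subsets of D are; their union exhausts D up to a null set. *)
Lemma radial_profile (D V : set 'rV[R]_N) (M : R) : lebesgue_measurable D ->
  measurable V -> D `<=` V ->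
  (forall x, V x -> enorm x <= M) ->
  exists E : set R, [/\ measurable E,
    E `<=` [set enorm x ^+ N | x in D] &
    leb (D `\` [set x | E (enorm x ^+ N)]) = 0%E].
Proof.
move=> mD mV DV VM; have Voo := lebesgue_rV_bounded mV VM.
have [F FP] : {F : nat -> set 'rV[R]_N & forall k,
    [/\ closed (F k), F k `<=` D & (leb (D `\` F k) < (k.+1%:R^-1)%:E)%E]}.
  apply: (@choice _ _ (fun k F => [/\ closed F, F `<=` D &
    (leb (D `\` F) < (k.+1%:R^-1)%:E)%E])) => k.
  by apply: (lebesgue_measurable_inner mD mV DV Voo); rewrite invr_gt0.
pose T k := [set enorm x ^+ N | x in F k].
have mT k : measurable (T k).
  have [cF FD _] := FP k.
  apply: compact_measurable; apply: continuous_compact.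
    exact/continuous_subspaceT/continuous_radial.
  apply: bounded_closed_compact => //.
  exists M; split; rewrite ?num_real// => K MK x /FD/DV/VM xM.
  by apply: le_trans (normr_le_enorm x) _; rewrite (le_trans xM)// ltW.
exists (\bigcup_k T k); split; first exact: bigcupT_measurable.
  by move=> _ [k _ [x Fx <-]]; exists x => //; have [_ FD _] := FP k; exact: FD.
apply/eqP; rewrite eq_le measure_ge0 andbT.
apply/lee_addgt0Pr => e e0; rewrite add0e.
have [k _ kP] := near_infty_natSinv_lt (PosNum e0).
have /= ke := kP _ (leqnn k); have [_ _ lk] := FP k.
apply: (@le_trans _ _ (leb (D `\` F k))); last first.
  by rewrite ltW// (lt_trans lk).
apply: le_outer_measure => x [Dx nx]; split => // Fx; apply: nx.
by exists k => //; exists x.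
Qed.

End radial.

(** * Quadratic splines as smooth steps *)

Section spline.
Context {R : realType}.
Implicit Types (y p q r : R).

Definition pos y := Num.max y 0.

Lemma continuous_pos : continuous pos.
Proof.
by move=> y; apply: continuous_max; [exact: cvg_id|exact: cst_continuous].
Qed.

(** Squaring removes the kink at 0, where the difference quotient is at most [|h|] in absolute
    value; hence steps built from squares of [pos] are C^1. *)
Lemma is_derive_sqr_pos y : is_derive y 1 (fun z => pos z ^+ 2) (2 * pos y).
Proof.
have [y0|y0|y0] := ltgtP y 0.
- rewrite /pos max_r ?ltW// mulr0.
  apply: (@near_eq_is_derive _ _ _ (cst (0:R))).
  near=> z; rewrite /= max_r ?expr0n// ltW//; near: z; exact: lt_nbhsl.
- rewrite /pos max_l ?ltW//.
  apply: (@near_eq_is_derive _ _ _ (fun z : R => z ^+ 2)).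
    near=> z; rewrite /= max_l// ltW//; near: z; exact: lt_nbhsr.
  have H := is_deriveX 2 (is_derive_id y (1 : R)).
  rewrite exprfctE in H; apply: (is_derive_eq H).
  by rewrite expr1 /GRing.scale/= mulr1.
- rewrite y0 /pos maxxx mulr0.
  have H : h^-1 *: (((fun z => Num.max z 0 ^+ 2) \o shift 0) (h *: (1 : R)) -
      Num.max 0 0 ^+ 2) @[h --> 0^'] --> (0 : R).
    apply/cvgr0Pnorm_le => e e0; near=> h.
    have h0 : h != 0 by near: h; exact: nbhs_dnbhs_neq.
    rewrite /= addr0 maxxx expr0n subr0 -[h *: 1]/(h * 1) mulr1.
    have hE : `|h| <= e.
      near: h; apply: dnbhs0_le => //.
    apply: le_trans hE; rewrite /GRing.scale/= normrM normfV ler_pdivrMl ?normr_gt0//.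
    rewrite normrX expr2 ler_pM//; case: (leP h 0) => ?; rewrite ?normr0//.
  by apply: DeriveDef; [apply/cvg_ex; exists 0|exact: cvg_lim H].
Unshelve. all: by end_near. Qed.

(* [step p r] is a C^1 primitive of the tent [hat p r], going from 0 to r^2 on
   [p - r, p + r]. *)
Definition hat p r y := pos (y - p + r) - 2 * pos (y - p) + pos (y - p - r).

Definition step p r y :=
  (pos (y - p + r) ^+ 2 - 2 * pos (y - p) ^+ 2 + pos (y - p - r) ^+ 2) / 2.

Lemma is_derive_shift p d y : is_derive y 1 (fun z : R => z - p + d) 1.
Proof.
have H := is_deriveD (is_deriveB (is_derive_id y (1 : R)) (is_derive_cst p y 1))
  (is_derive_cst d y 1).
by apply: (is_derive_eq H); rewrite subr0 addr0.
Qed.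

Lemma continuous_hat p r : continuous (hat p r).
Proof.
have c d : continuous (fun y => pos (y - p + d)).
  move=> y; apply: (@continuous_comp _ _ _ (fun y => y - p + d) pos).
    exact: is_derive_continuous (is_derive_shift p d y).
  exact: continuous_pos.
move=> y; rewrite /hat; apply: cvgD; last exact: c.
apply: cvgB; first exact: c.
apply: cvgM; first exact: cvg_cst.
have := c 0; under eq_fun do rewrite addr0; exact.
Qed.

Lemma is_derive_step p r y : is_derive y 1 (step p r) (hat p r y).
Proof.
have D d : is_derive y 1 (fun y => pos (y - p + d) ^+ 2) (2 * pos (y - p + d)).
  have := @is_derive1_comp R (fun z => pos z ^+ 2) (fun z => z - p + d) y _ _
    (is_derive_sqr_pos _) (is_derive_shift p d y).
  by rewrite mulr1.
have := is_deriveZ 2^-1 (is_deriveD (is_deriveB (D r) (is_deriveZ 2 (D 0))) (D (- r))).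
move=> H; have -> : step p r = (2^-1 \*: ((fun y0 : R => pos (y0 - p + r) ^+ 2) -
   2 \*: (fun y0 : R => pos (y0 - p + 0) ^+ 2) +
   (fun y0 : R => pos (y0 - p - r) ^+ 2))).
  apply/funext => z; rewrite /step mulrC.
  rewrite -[RHS]/(2^-1 * (pos (z - p + r) ^+ 2 - 2 * pos (z - p + 0) ^+ 2 +
    pos (z - p - r) ^+ 2)).
  by rewrite addr0.
apply: (is_derive_eq H); rewrite /hat /GRing.scale/= addr0.
by field.
Qed.

Lemma hat_ge0 p r y : 0 < r -> 0 <= hat p r y.
Proof.
move=> r0; rewrite /hat /pos.
case: (leP (y - p + r) 0); case: (leP (y - p) 0); case: (leP (y - p - r) 0); lra.
Qed.

Lemma hat_le p r y : 0 < r -> hat p r y <= r.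
Proof.
move=> r0; rewrite /hat /pos.
case: (leP (y - p + r) 0); case: (leP (y - p) 0); case: (leP (y - p - r) 0); lra.
Qed.

Lemma hat_out p r y : 0 < r -> ~ ball p r y -> hat p r y = 0.
Proof.
move=> r0; rewrite /ball/= => /negP; rewrite -leNgt ler_normr /hat /pos.
case: (leP (y - p + r) 0); case: (leP (y - p) 0); case: (leP (y - p - r) 0) => ? ? ? /orP[]; lra.
Qed.

Lemma step_ge0 p r y : 0 < r -> 0 <= step p r y.
Proof.
move=> r0; rewrite /step /pos.
case: (leP (y - p + r) 0); case: (leP (y - p) 0); case: (leP (y - p - r) 0); nra.
Qed.

Lemma step_le p r y : 0 < r -> step p r y <= r ^+ 2.
Proof.
move=> r0; rewrite /step /pos.
case: (leP (y - p + r) 0); case: (leP (y - p) 0); case: (leP (y - p - r) 0); nra.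
Qed.

Lemma step_left p r y : 0 < r -> y <= p - r -> step p r y = 0.
Proof.
move=> r0 yp; rewrite /step /pos.
case: (leP (y - p + r) 0); case: (leP (y - p) 0); case: (leP (y - p - r) 0); nra.
Qed.

Lemma step_right p r y : 0 < r -> p + r <= y -> step p r y = r ^+ 2.
Proof.
move=> r0 yp; rewrite /step /pos.
case: (leP (y - p + r) 0); case: (leP (y - p) 0); case: (leP (y - p - r) 0); nra.
Qed.

End spline.

(** * Density points tested against tents *)

Section density.
Context {R : realType}.
Local Notation mu := (@lebesgue_measure R).

Lemma measurable_hat p r : measurable_fun setT (hat p r : R -> R).
Proof. by apply: continuous_measurable_fun; exact: continuous_hat. Qed.

Lemma integral_hat (p r : R) : 0 < r ->
  (\int[mu]_y (hat p r y)%:E = (r ^+ 2)%:E)%E.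
Proof.
move=> r0; have pr : p - r < p + r by lra.
transitivity (\int[mu]_(y in `[(p - r)%R, (p + r)%R]) (hat p r y)%:E)%E.
  rewrite [RHS]integral_mkcond; apply: eq_integral => y _; rewrite patchE.
  case: ifPn => //; rewrite mem_setE in_itv/= => yp.
  rewrite hat_out//; rewrite /ball/= => yb; move/negP: yp; apply.
  by move: yb; rewrite ltr_norml => /andP[? ?]; apply/andP; split; lra.
rewrite (integral_is_derive pr (is_derive_step p r)); last exact: continuous_hat.
by rewrite (@step_right _ p r (p + r))// (@step_left _ p r (p - r))// subr0.
Qed.

(** [p] is a point of density 0 of [A]. Density 1 is expressed by taking the complement. *)
Definition dispersed (A : set R) (p : R) :=
  (mu (A `&` ball p r) / mu (ball p r))%E @[r --> 0^'+] --> 0%E.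

(** The tent is at most [r] and lives on a ball of length [2 * r], so a set filling a fraction
    [e / 2] of that ball carries at most [e * r ^+ 2] of the total mass [r ^+ 2]. *)
Lemma dispersed_hat (A : set R) p e : measurable A -> dispersed A p -> 0 < e ->
  \forall r \near 0^'+, (\int[mu]_(y in A) (hat p r y)%:E <= (e * r ^+ 2)%:E)%E.
Proof.
move=> mA /fine_cvgP[fin /cvgrPdist_lt cv] e0.
have e20 : 0 < e / 2 by rewrite divr_gt0.
near=> r.
have r0 : 0 < r by near: r; exact: nbhs_right_gt.
have mb : measurable (ball p r) by exact: measurable_ball.
have mAb : measurable (A `&` ball p r) by exact: measurableI.
have Abfin : mu (A `&` ball p r) \is a fin_num.
  rewrite ge0_fin_numE// (@le_lt_trans _ _ (mu (ball p r)))//.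
    by apply: le_measure; rewrite ?inE//; exact: subIsetr.
  by rewrite lebesgue_measure_ball ?ltry// ltW.
have : `|0 - fine (mu (A `&` ball p r) / mu (ball p r))%E| < e / 2.
  by near: r; exact: cv.
rewrite (lebesgue_measure_ball _ (ltW r0)) inver mulrn_eq0/= gt_eqF//.
rewrite -(fineK Abfin) -EFinM/= sub0r normrN ger0_norm; last first.
  by rewrite divr_ge0 ?fine_ge0// mulrn_wge0// ltW.
rewrite ltr_pdivrMr ?mulrn_wgt0// => Ab.
apply: (@le_trans _ _ (\int[mu]_(y in A `&` ball p r) (cst r%:E) y)%E).
  rewrite [leLHS]integral_mkcond [leRHS]integral_mkcond.
  apply: ge0_le_integral => //.
  - by move=> y _; rewrite patchE; case: ifP => // _; rewrite lee_fin hat_ge0.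
  - apply/(measurable_restrictT _ mA)/measurable_funTS/measurable_EFinP.
    exact: measurable_hat.
  - by apply/(measurable_restrictT _ mAb).
  - move=> y _; rewrite !patchE in_setI; case: (boolP (y \in A)) => //= yA.
    case: (boolP (y \in _)) => yb; first by rewrite lee_fin hat_le.
    by rewrite hat_out// => ?; move/negP: yb; apply; rewrite inE.
rewrite (_ : integral _ _ _ = (r * fine (mu (A `&` ball p r)))%:E); last first.
  by rewrite integral_cst// EFinM (fineK Abfin).
rewrite lee_fin.
apply: (@le_trans _ _ (r * (e / 2 * (r *+ 2)))).
  by rewrite ler_wpM2l// ltW.
by rewrite (_ : r * _ = e * r ^+ 2)//; field.
Unshelve. all: by end_near. Qed.

Lemma dispersed_setC_hat (A : set R) p e : measurable A -> dispersed (~` A) p ->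
  0 < e -> \forall r \near 0^'+,
    (((1 - e) * r ^+ 2)%:E <= \int[mu]_(y in A) (hat p r y)%:E)%E.
Proof.
move=> mA dA e0; near=> r.
have r0 : 0 < r by near: r; exact: nbhs_right_gt.
have H : (\int[mu]_(y in ~` A) (hat p r y)%:E <= (e * r ^+ 2)%:E)%E.
  by near: r; apply: dispersed_hat => //; exact: measurableC.
have mh : measurable_fun setT (EFin \o hat p r).
  by apply/measurable_EFinP; exact: measurable_hat.
have := integral_hat p r0.
rewrite -(setUv A) ge0_integral_setU//;
  [|exact: measurableC|by rewrite setUv| |exact/disj_setPCl]; last first.
  by move=> y _; rewrite lee_fin hat_ge0.
set I1 := (X in (X + _)%E); set I2 := (X in (_ + X)%E) => E.
have I1fin : I1 \is a fin_num.
  rewrite ge0_fin_numE; last by apply: integral_ge0 => y _; rewrite lee_fin hat_ge0.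
  apply: (@le_lt_trans _ _ (I1 + I2)%E); last by rewrite E ltry.
  by rewrite leeDl//; apply: integral_ge0 => y _; rewrite lee_fin hat_ge0.
rewrite mulrBl mul1r EFinB leeBlDr// -E.
by rewrite leeD2l.
Unshelve. all: by end_near. Qed.

(** By Lebesgue's density theorem for the complement of [A], almost every point of [A] qualifies,
    and a set of positive measure contains one. *)
Lemma exists_dispersed_setC (A B : set R) : measurable A -> measurable B ->
  (0 < mu (A `&` B))%E -> exists2 p, (A `&` B) p & dispersed (~` A) p.
Proof.
move=> mA mB AB0; apply: contrapT => nP.
have [N [mN N0 NP]] := lebesgue_density (measurableC mA).
suff : (mu (A `&` B) <= mu N)%E by rewrite N0 leNgt AB0.
apply: le_measure; rewrite ?inE//; first exact: measurableI.
move=> p [Ap Bp]; apply: NP => /= H; apply: nP; exists p => //.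
by move: H; rewrite indicE memNset.
Qed.

(** The radius is common to both points because the field is built from two steps of equal height
    [r ^+ 2]. It is taken small enough to keep both tents strictly between [a + s'] and [b]. *)
Lemma exists_transition (E : set R) (a b s s' e : R) : measurable E ->
  E `<=` `[a, b[ -> mu E = s%:E -> 0 <= s' -> s' < s -> s <= (b - a) / 2 -> 0 < e ->
  exists p q r, [/\ 0 < r,
    a + s' < p - r /\ p + r < b, a + s' < q - r /\ q + r < b,
    (((1 - e) * r ^+ 2)%:E <= \int[mu]_(y in E) (hat p r y)%:E)%E &
    (\int[mu]_(y in E) (hat q r y)%:E <= (e * r ^+ 2)%:E)%E].
Proof.
move=> mE Eab Es s'0 s's sb e0.
pose I := `]a + s', b[%classic : set R.
have mI : measurable I by exact: measurable_itv.
have lI : mu I = (b - a - s')%:E.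
  have sb' : a + s' < b by lra.
  by rewrite /I lebesgue_measure_itv/= lte_fin sb' -EFinB; congr (_%:E); ring.
have mC : measurable (~` E) by exact: measurableC.
have [p [Ep Ip] dp] : exists2 p, (E `&` I) p & dispersed (~` E) p.
  apply: exists_dispersed_setC => //.
  have EsubU : E `<=` (E `&` I) `|` `[a, a + s'].
    move=> y Ey; have := Eab _ Ey; rewrite /= !in_itv/= => /andP[ay yb].
    have [ys'|ys'] := leP y (a + s'); first by right; rewrite ay.
    by left; split => //; rewrite /I/= in_itv/= ys'.
  rewrite lt0e measure_ge0 andbT; apply/eqP => EI0.
  (* If [E] were null beyond [a + s'], it would fit up to a null set in an interval of length
     [s']. *)
  have : (s%:E <= s'%:E)%E; last by rewrite lee_fin leNgt s's.
  rewrite -Es; apply: (@le_trans _ _ (mu ((E `&` I) `|` `[a, a + s']))).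
    apply: le_measure; rewrite ?inE//.
    by apply: measurableU; [exact: measurableI|exact: measurable_itv].
  apply: (@le_trans _ _ (mu (E `&` I) + mu `[a, (a + s')%R]%classic)%E).
    by apply: measureU2 => //; exact: measurableI.
  rewrite [X in (X + _)%E]EI0 add0e lebesgue_measure_itv/= lte_fin.
  by case: ifPn => _; [rewrite -EFinB lee_fin; lra|rewrite lee_fin].
have [q [Eq Iq] dq] : exists2 q, (~` E `&` I) q & dispersed (~` ~` E) q.
  apply: exists_dispersed_setC => //.
  rewrite lt0e measure_ge0 andbT; apply/eqP => EI0.
  (* If [E] filled [I] up to a null set, then [b - a - s' <= s], against [s' < s <= (b - a) / 2]. *)
  have : ((b - a - s')%:E <= s%:E)%E; last by rewrite lee_fin leNgt; lra.
  rewrite -lI; apply: (@le_trans _ _ (mu ((~` E `&` I) `|` E))).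
    apply: le_measure; rewrite ?inE//.
    + by apply: measurableU => //; exact: measurableI.
    + by move=> y Iy; have [|] := pselect (E y); [right|left].
  apply: (@le_trans _ _ (mu (~` E `&` I) + mu E)%E).
    by apply: measureU2 => //; exact: measurableI.
  by rewrite [X in (X + _)%E]EI0 add0e Es.
rewrite setCK in dq.
move: Ip Iq; rewrite /I/= !in_itv/= => /andP[p1 p2] /andP[q1 q2].
suff [r [r0 H1 H2 H3 H4]] : exists r, [/\ 0 < r, r < Num.min (p - (a + s')) (b - p),
    r < Num.min (q - (a + s')) (b - q),
    (((1 - e) * r ^+ 2)%:E <= \int[mu]_(y in E) (hat p r y)%:E)%E &
    (\int[mu]_(y in E) (hat q r y)%:E <= (e * r ^+ 2)%:E)%E].
  move: H1 H2; rewrite !lt_min => /andP[? ?] /andP[? ?].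
  by exists p, q, r; split => //; split; lra.
near (0 : R)^'+ => r; exists r; split.
- by near: r; exact: nbhs_right_gt.
- by near: r; apply: nbhs_right_lt; rewrite lt_min; apply/andP; split; lra.
- by near: r; apply: nbhs_right_lt; rewrite lt_min; apply/andP; split; lra.
- by near: r; exact: dispersed_setC_hat.
- by near: r; exact: dispersed_hat.
Unshelve. all: by end_near. Qed.

End density.

(** * The radial vector field *)

Lemma is_derive_of_line (R : realType) n (f : 'rV[R]_n -> R) (x v : 'rV[R]_n) df :
  is_derive (0 : R) 1 (fun s : R => f (s *: v + x)) df -> is_derive x v f df.
Proof.
have E : (fun h => h^-1 *: (((fun s : R => f (s *: v + x)) \o shift 0) (h *: (1 : R)) -
    f (0 *: v + x))) = (fun h => h^-1 *: ((f \o shift x) (h *: v) - f x)).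
  by apply/funext => h /=; rewrite addr0 -[h *: 1]/(h * 1) mulr1 scale0r add0r.
by case; rewrite /derivable /derive E => H1 H2; exact: DeriveDef.
Qed.

(* In the variable t = |x|^N, the field F(t) x / t has divergence N F'(t). *)
Section radial_field.
Context {R : realType} (n : nat) (F f : R -> R) (c1 c2 h : R) (U : set 'rV[R]_n.+1).
Local Notation N := n.+1.
Hypotheses (dF : forall y : R, is_derive y 1 F (f y)) (cf : continuous f) (c10 : 0 < c1)
  (Fleft : forall y : R, y <= c1 -> F y = 0) (fleft : forall y : R, y <= c1 -> f y = 0)
  (Fright : forall y : R, c2 <= y -> F y = 0)
  (Fh : forall y : R, `|F y| <= h)
  (hc1 : forall e : R, 0 <= e -> c1 <= e ^+ N -> h <= e ^+ n)
  (cU : forall x : 'rV[R]_N, c1 <= enorm x ^+ N <= c2 -> U x).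

(** The working variable is v = |x|^2, a polynomial in the coordinates, unlike the norm. [tau v] is
    t, so [G v] is F(t) / t; [G1] is its derivative, since dt/dv = N t / (2 v). *)
Let tau (v : R) := Num.sqrt v ^+ N.
Let G v := F (tau v) / tau v.
Let G1 v := (f (tau v) - F (tau v) / tau v) * (N%:R / 2 / v).
Let sq (x : 'rV[R]_N) := \sum_i x ord0 i ^+ 2.
Let phi (x : 'rV[R]_N) := G (sq x) *: x.

Let tau_continuous : continuous tau.
Proof.
move=> v; apply: (@continuous_comp _ _ _ (@Num.sqrt R) (fun z : R => z ^+ N)).
  exact: sqrt_continuous.
exact: exprn_continuous.
Qed.

Let tau_le0 (v : R) : v <= 0 -> tau v = 0.
Proof. by move=> v0; rewrite /tau ler0_sqrtr// expr0n. Qed.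

(** [Num.sqrt] is 0 on negative numbers, so [tau] vanishes for [v <= 0] and stays below [c1] nearby.
    There [F] and [f] are 0, so the divisions by [tau v] and [v] create no singularity in [G] and
    [G1]. *)
Let near_le0 (v : R) : v <= 0 -> \forall z \near v, tau z < c1.
Proof.
move=> v0; have oT : open [set z : R | tau z < c1].
  apply: (@open_comp _ _ tau [set y : R | y < c1]); last exact: open_lt.
  by move=> z _; exact: tau_continuous.
have tv : tau v < c1 by rewrite tau_le0.
exact: open_nbhs_nbhs (conj oT tv).
Qed.

Let is_derive_tau (v : R) : 0 < v -> is_derive v 1 tau (tau v * (N%:R / 2 / v)).
Proof.
move=> v0.
have := is_deriveX N (is_derive1_sqrt v0).
rewrite exprfctE => H; apply: (is_derive_eq H).
have s0 : Num.sqrt v != 0 by rewrite gt_eqF// sqrtr_gt0.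
rewrite /GRing.scale/= /tau exprS [X in _ = _ * (_ / X)](_ : v = Num.sqrt v ^+ 2).
  by field.
by rewrite sqr_sqrtr// ltW.
Qed.

Let is_derive_G (v : R) : is_derive v 1 G (G1 v).
Proof.
have [v0|v0] := leP v 0.
  have tc : tau v <= c1 by rewrite tau_le0// ltW.
  have -> : G1 v = 0 by rewrite /G1 Fleft// fleft// mul0r subr0 mul0r.
  apply: (@near_eq_is_derive _ _ _ (cst (0 : R))).
  by apply: filterS (near_le0 v0) => z /ltW zc; rewrite /G Fleft// mul0r.
have t0 : 0 < tau v by rewrite exprn_gt0// sqrtr_gt0.
have dFt := is_derive1_comp (dF (tau v)) (is_derive_tau v0).
have dV : is_derive v 1 (fun y => (tau y)^-1) (- tau v ^- 2 *: (tau v * (N%:R / 2 / v))).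
  by apply: (@is_deriveV _ tau) => //; [rewrite gt_eqF|exact: is_derive_tau].
have H := is_deriveM dFt dV.
apply: (is_derive_eq H); rewrite /GRing.scale/= /G1.
by field; rewrite !gt_eqF.
Qed.

Let continuous_G : continuous G.
Proof. by move=> v; exact: is_derive_continuous (is_derive_G v). Qed.

Let continuous_G1 : continuous G1.
Proof.
move=> v; have [v0|v0] := leP v 0.
  have tc : tau v <= c1 by rewrite tau_le0// ltW.
  have G10 : G1 v = 0 by rewrite /G1 Fleft// fleft// mul0r subr0 mul0r.
  rewrite /continuous_at G10; apply: cvg_near_cst.
  by apply: filterS (near_le0 v0) => z /ltW zc; rewrite /G1 fleft// Fleft// mul0r subr0 mul0r.
apply: cvgM; [apply: cvgB|].
- apply: (@continuous_comp _ _ _ tau f); [exact: tau_continuous|exact: cf].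
- exact: continuous_G.
- apply: cvgM; first exact: cvg_cst.
  by apply: cvgV; [rewrite gt_eqF|exact: cvg_id].
Qed.

(** Along the line through [x] in direction [i], [sq] is a quadratic polynomial in the parameter and
    coordinate [j] is affine, so the product and chain rules in one variable suffice. *)
Let is_derive_phi i j (x : 'rV[R]_N) : is_derive x (delta_mx ord0 i) (fun y => phi y ord0 j)
  (2 * x ord0 i * x ord0 j * G1 (sq x) + G (sq x) * (i == j)%:R).
Proof.
apply: is_derive_of_line.
have sqE (s : R) : sq (s *: delta_mx ord0 i + x) = sq x + 2 * x ord0 i * s + s ^+ 2.
  rewrite /sq (bigD1 i)//= [in RHS](bigD1 i)//= !mxE !eqxx mulr1.
  rewrite [X in _ + X = _](eq_bigr (fun k => x ord0 k ^+ 2)); last first.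
    by move=> k ki; rewrite !mxE (negbTE ki) andbF mulr0 add0r.
  by rewrite sqrrD; ring.
have dsq : is_derive (0 : R) 1 (fun s => sq (s *: delta_mx ord0 i + x)) (2 * x ord0 i).
  have H := is_deriveD (is_deriveD (is_derive_cst (sq x) (0 : R) (1 : R))
    (is_deriveZ (2 * x ord0 i) (is_derive_id (0 : R) 1))) (is_deriveX 2 (is_derive_id (0 : R) (1 : R))).
  rewrite exprfctE in H.
  have -> : (fun s => sq (s *: delta_mx ord0 i + x)) =
     (cst (sq x) + 2 * x ord0 i \*: id + (fun s : R => s ^+ 2)).
    by apply/funext => s; rewrite sqE.
  apply: (is_derive_eq H); rewrite /GRing.scale/= add0r expr1 mulr0 mul0r addr0.
  by rewrite mulr1.
have sq0 : sq (0 *: delta_mx ord0 i + x) = sq x by rewrite scale0r add0r.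
have dG : is_derive (0 : R) 1 (G \o (fun s => sq (s *: delta_mx ord0 i + x)))
    (G1 (sq x) * (2 * x ord0 i)).
  by apply: is_derive1_comp => //; rewrite sq0.
have dx : is_derive (0 : R) 1 (fun s : R => (i == j)%:R * s + x ord0 j) (i == j)%:R.
  have H := is_deriveD (is_deriveZ ((i == j)%:R : R) (is_derive_id (0 : R) 1))
     (is_derive_cst (x ord0 j) (0 : R) (1 : R)).
  by apply: (is_derive_eq H); rewrite /GRing.scale/= mulr1 addr0.
have H := is_deriveM dG dx.
have -> : (fun s => phi (s *: delta_mx ord0 i + x) ord0 j) =
    (G \o (fun s => sq (s *: delta_mx ord0 i + x))) * (fun s : R => (i == j)%:R * s + x ord0 j).
  apply/funext => s; rewrite /phi mxE [X in _ * X]mxE [X in _ * (X + _)]mxE.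
  by rewrite [X in _ * (_ * X + _)]mxE eqxx/= eq_sym (mulrC s).
apply: (is_derive_eq H); rewrite /GRing.scale/= sq0 mulr0 add0r.
by ring.
Qed.

Let continuous_sq : continuous sq.
Proof. exact: continuous_sqr_enorm. Qed.

Let phi_out x : ~ (c1 <= enorm x ^+ N <= c2) -> phi x = 0.
Proof.
move=> xc; rewrite /phi /G -[tau (sq x)]/(enorm x ^+ N).
have [xc1|xc1] := leP (enorm x ^+ N) c1; first by rewrite Fleft// mul0r scale0r.
have [xc2|xc2] := leP c2 (enorm x ^+ N); first by rewrite Fright// mul0r scale0r.
by case: xc; rewrite !ltW.
Qed.

Let fsupport_phi x : fsupport phi x -> c1 <= enorm x ^+ N <= c2.
Proof.
have cK : closed [set x : 'rV[R]_N | c1 <= enorm x ^+ N <= c2].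
  rewrite (_ : mkset _ = (fun x => enorm x ^+ N) @^-1` `[c1, c2]%classic).
    apply: closed_comp => [y _|]; first exact: continuous_radial.
    exact: interval_closed.
  by apply/seteqP; split => y /=; rewrite in_itv.
move=> sx; apply: cK; apply: closure_subset sx => y /= phiy.
by apply: contrapT => /phi_out/eqP; apply/negP.
Qed.

Lemma exists_radial_field : exists phi : 'rV[R]_N -> 'rV[R]_N, [/\
  test_field U phi, forall x, enorm (phi x) <= 1 &
  forall x, divergence phi x = N%:R * f (enorm x ^+ N)].
Proof.
exists phi; split.
- split.
  + move=> j i; split => [x|]; first by case: (is_derive_phi i j x).
    rewrite (_ : partial i _ = fun x : 'rV[R]_N =>
      2 * x ord0 i * x ord0 j * G1 (sq x) + G (sq x) * (i == j)%:R); last first.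
      by apply/funext => x; rewrite /partial; apply: derive_val; exact: is_derive_phi.
    have cc k : continuous (fun x : 'rV[R]_N => x ord0 k).
      by move=> x; exact: coord_continuous.
    have cM (u v : 'rV[R]_N -> R) : continuous u -> continuous v ->
        continuous (fun x => u x * v x).
      by move=> cu cv x; exact: cvgM (cu x) (cv x).
    have cD (u v : 'rV[R]_N -> R) : continuous u -> continuous v ->
        continuous (fun x => u x + v x).
      by move=> cu cv x; exact: cvgD (cu x) (cv x).
    apply: (cD _ _); apply: (cM _ _).
    * apply: (cM _ _); last exact: cc.
      by apply: (cM _ _); [exact: cst_continuous|exact: cc].
    * move=> x; apply: (@continuous_comp _ _ _ sq G1); [exact: continuous_sq|exact: continuous_G1].
    * move=> x; apply: (@continuous_comp _ _ _ sq G); [exact: continuous_sq|exact: continuous_G].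
    * exact: cst_continuous.
  + apply: bounded_closed_compact; last exact: closed_closure.
    (* A norm above 1 is at most its own [N]-th power, hence at most [c2]. *)
    exists (Num.max 1 c2); split; rewrite ?num_real// => K cK x /fsupport_phi /andP[_ xc2].
    apply: le_trans (normr_le_enorm x) _; apply: le_trans (ltW cK).
    rewrite le_max; have [//|x1] := leP (enorm x) 1.
    by apply: le_trans xc2; rewrite exprS ler_peMr ?enorm_ge0// exprn_ege1// ltW.
  + by move=> x /fsupport_phi/cU.
(* The norm is |F(t)| |x| / |x|^N, at most h / |x|^n, and [hc1] bounds this by 1 on the support. *)
- move=> x; rewrite /phi enormZ /G -[tau (sq x)]/(enorm x ^+ N).
  have [xc1|xc1] := leP (enorm x ^+ N) c1.
    by rewrite Fleft// mul0r normr0 mul0r.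
  have t0 : 0 < enorm x ^+ N by exact: lt_trans xc1.
  have e0 : 0 < enorm x.
    rewrite lt_neqAle enorm_ge0 andbT.
    by apply: contraTneq t0 => <-; rewrite expr0n ltxx.
  rewrite normrM normfV (gtr0_norm t0) mulrAC ler_pdivrMr// mul1r.
  rewrite [leRHS]exprSr ler_wpM2r ?enorm_ge0// (le_trans (Fh _))// hc1// ltW//.
- move=> x; rewrite /divergence.
  (* Summing over [i] gives 2 v [G1 v] + N [G v] with v = [sq x]; the two terms in F(t) / t cancel,
     and N f(t) remains. *)
  rewrite (eq_bigr (fun i => 2 * x ord0 i ^+ 2 * G1 (sq x) + G (sq x))); last first.
    move=> i _; rewrite /partial; rewrite (derive_val (is_derive := is_derive_phi i i x)).
    by rewrite eqxx mulr1 expr2 mulrA.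
  rewrite big_split/= -mulr_suml -mulr_sumr sumr_const card_ord -/(sq x) -[X in _ + X]mulr_natl.
  rewrite /G1 /G -[tau (sq x)]/(enorm x ^+ N).
  have : 0 <= sq x by apply: sumr_ge0 => i _; exact: sqr_ge0.
  rewrite le0r => /orP[/eqP sq0|sq0].
    rewrite sq0 mulr0 mul0r add0r (_ : enorm x = 0).
      by rewrite expr0n/= Fleft ?fleft ?(ltW c10)// mul0r !mulr0.
    by rewrite /enorm -/(sq x) sq0 sqrtr0.
  have t0 : 0 < enorm x ^+ N by rewrite exprn_gt0// sqrtr_gt0.
  by field; rewrite !gt_eqF.
Qed.

End radial_field.

(** * The lower bound for radial sets *)

Section radial_competitors.
Context {R : realType} (n : nat) (l L : R).
Hypotheses (l0 : 0 <= l) (lL : l < L).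
Local Notation N := n.+1.
Local Notation w := (unit_ball_volume R N).
Let Omega : set 'rV[R]_N := eball 0 L `\` eball 0 l.
Let L0 : 0 < L := le_lt_trans l0 lL.

Lemma annulusE (x : 'rV[R]_N) : Omega x <-> l <= enorm x < L.
Proof.
rewrite /Omega /setD/= !eball0E/=; split => [[-> /negP]|/andP[xl ->]].
  by rewrite -leNgt => ->.
by split => //; apply/negP; rewrite -leNgt.
Qed.

Lemma annulus_interior (x : 'rV[R]_N) :
  l ^+ N < enorm x ^+ N < L ^+ N -> Omega° x.
Proof.
move=> xlL; pose V := [set x : 'rV[R]_N | l ^+ N < enorm x ^+ N < L ^+ N].
have oV : open V.
  rewrite (_ : V = (fun x => enorm x ^+ N) @^-1` `]l ^+ N, L ^+ N[%classic).
    apply: open_comp => [y _|]; first exact: continuous_radial.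
    exact: interval_open.
  by apply/seteqP; split => y /=; rewrite in_itv.
have VO : V `<=` Omega.
  move=> y /andP[yl yL]; apply/annulusE; apply/andP; split.
    by rewrite leNgt; apply: contraTN yl => yl; rewrite -leNgt ler_pXn2r ?nnegrE ?enorm_ge0// ltW.
  by move: yL; rewrite ltr_pXn2r ?nnegrE ?enorm_ge0// ltW.
by rewrite /interior/=; apply: filterS VO _; exact: open_nbhs_nbhs.
Qed.

Section competitor.
Variables (D : set 'rV[R]_N) (E : set R) (s s' e r0 : R).
Hypotheses (mD : lebesgue_measurable D) (mE : measurable E)
  (ED : [set x | E (enorm x ^+ N)] `<=` D)
  (DE : leb (D `\` [set x | E (enorm x ^+ N)]) = 0%E)
  (Eab : E `<=` `[l ^+ N, L ^+ N[) (Es : lebesgue_measure E = s%:E)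
  (s'0 : 0 <= s') (s's : s' < s) (s_le : s <= (L ^+ N - l ^+ N) / 2) (e0 : 0 < e)
  (r00 : 0 < r0) (r0N : (L ^+ N + l ^+ N) / 2 <= r0 ^+ N).
Let S := [set x : 'rV[R]_N | E (enorm x ^+ N)].

Let mS : measurable S.
Proof. exact: measurable_radial_preimage. Qed.

Let integral_hat_radial p r : 0 < r ->
  (\int[lebesgue_rV N]_x (\1_S x * hat p r (enorm x ^+ N))%:E =
  w%:E * \int[lebesgue_measure]_(y in E) (hat p r y)%:E)%E.
Proof.
move=> r_gt0; rewrite -ge0_integral_radial//; last 3 first.
- move=> y /Eab; rewrite /= in_itv/= => /andP[+ _]; apply: le_trans.
  exact: exprn_ge0.
- exact: measurable_hat.
- by move=> y; exact: hat_ge0.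
rewrite [RHS]integral_mkcond; apply: eq_integral => x _; rewrite patchE indicE.
by case: ifPn; rewrite ?mul1r ?mul0r.
Qed.

Let integrable_hat_radial p r : 0 < r -> (lebesgue_rV N).-integrable setT
  (fun x => (\1_S x * hat p r (enorm x ^+ N))%:E).
Proof.
move=> r_gt0; apply: (@integrable_supported_in _ _ _ L r).
- apply: measurable_funM => //.
  exact: (measurableT_comp (measurable_hat p r) (@measurable_radial R n)).
- move=> x; rewrite normrM (ger0_norm (hat_ge0 _ _ r_gt0)).
  rewrite indicE; case: (_ \in _); rewrite ?normr1 ?normr0 ?mul1r ?mul0r ?hat_le//.
  exact: ltW.
- move=> x i Lx; rewrite indicE memNset ?mul0r// => /Eab; rewrite /= in_itv/= => /andP[_].
  rewrite ltr_pXn2r ?nnegrE ?enorm_ge0 ?(ltW L0)// => xL.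
  by have := lt_le_trans Lx (coord_le_enorm x i); rewrite ltNge (ltW xL).
Qed.

(** The integral of the divergence over [D] is N w k times the tent integral at [p] minus the one at
    [q], both over [E]. The first is at least [(1 - e) * r ^+ 2] and the second at most
    [e * r ^+ 2], whence the factor [1 - 2 * e]. *)
Lemma perimeter_radial_ge :
  ((N%:R * w * ((l ^+ N + s') / r0) * (1 - 2 * e))%:E <= perimeter D Omega)%E.
Proof.
have [p [q [r [r_gt0 [p1 p2] [q1 q2] Hp Hq]]]] :=
  exists_transition mE Eab Es s'0 s's s_le e0.
have lN0 : 0 <= l ^+ N by exact: exprn_ge0.
pose h := (l ^+ N + s') / r0.
have h0 : 0 <= h by rewrite divr_ge0 ?addr_ge0// ltW.
(* Normalizes the height [r ^+ 2] of the steps to [h]. *)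
pose k := h / r ^+ 2.
have k0 : 0 <= k by rewrite divr_ge0// sqr_ge0.
(* The difference of steps covers both orders of [p] and [q]; only the sign of the plateau changes.
   As both steps lie in [[0, r ^+ 2]], [|F| <= h] holds even if the tents overlap. *)
pose F y := k * (step p r y - step q r y).
pose f y := k * (hat p r y - hat q r y).
pose c1 := Num.min (p - r) (q - r).
pose c2 := Num.max (p + r) (q + r).
have c1lt : l ^+ N + s' < c1 by rewrite lt_min p1 q1.
have c2lt : c2 < L ^+ N by rewrite gt_max p2 q2.
have dF (y : R) : is_derive y 1 F (f y).
  exact: is_deriveZ (is_deriveB (is_derive_step p r y) (is_derive_step q r y)).
have cf : continuous f.
  move=> y; apply: cvgM; first exact: cvg_cst.
  by apply: cvgB; exact: continuous_hat.
have out z y : y <= z - r \/ z + r <= y -> ~ ball z r y.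
  by move=> H; rewrite /ball/= => /ltr_normlP[]; case: H; lra.
have [phi [tphi phi1 divphi]] : exists phi : 'rV[R]_N -> 'rV[R]_N, [/\
    test_field Omega° phi, forall x, enorm (phi x) <= 1 &
    forall x, divergence phi x = N%:R * f (enorm x ^+ N)].
  apply: (@exists_radial_field R n F f c1 c2 h) => //.
  - by rewrite (le_lt_trans _ c1lt)// addr_ge0.
  - by move=> y; rewrite le_min => /andP[? ?]; rewrite /F !step_left// subrr mulr0.
  - move=> y; rewrite le_min => /andP[? ?]; rewrite /f !hat_out ?subrr ?mulr0//;
      by apply: out; left.
  - by move=> y; rewrite ge_max => /andP[? ?]; rewrite /F !step_right// subrr mulr0.
  - move=> y; rewrite /F normrM (ger0_norm k0) /k -mulrA ler_piMr//.
    rewrite mulrC ler_pdivrMr ?exprn_gt0// mul1r ler_norml.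
    have := step_ge0 p y r_gt0; have := step_ge0 q y r_gt0.
    have := step_le p y r_gt0; have := step_le q y r_gt0; lra.
  (* Up to [r0], [l ^+ N + s' <= d ^+ N <= d ^+ n * r0]. Beyond [r0], the bound on [s] gives
     [l ^+ N + s' <= r0 ^+ N], and [r0 ^+ N <= d ^+ n * r0]. *)
  - move=> d d0 c1d; have hd : l ^+ N + s' <= d ^+ N by rewrite ltW// (lt_le_trans c1lt).
    rewrite /h ler_pdivrMr//; have [dr|rd] := leP d r0.
      by rewrite (le_trans hd)// exprSr ler_wpM2l// exprn_ge0.
    have : l ^+ N + s' <= r0 ^+ N.
      apply: le_trans r0N; move: (l ^+ N) (L ^+ N) s_le => A B; move: s's; lra.
    move/le_trans; apply; rewrite exprSr ler_wpM2r ?(ltW r00)//.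
    by rewrite lerXn2r ?nnegrE ?(ltW r00)// ltW.
  - move=> x /andP[xc1 xc2]; apply: annulus_interior.
    rewrite (le_lt_trans xc2 c2lt) andbT (lt_le_trans _ xc1)// (le_lt_trans _ c1lt)//.
    by rewrite lerDl.
apply: (@le_trans _ _
    (\int[@leb R N]_(x in Omega°) (\1_D x * divergence phi x)%:E)%E); last first.
  by apply: ereal_sup_ubound; exists phi.
have oO : open Omega° by exact: open_interior.
have mO : measurable Omega° by exact: open_measurable_rV.
have mdiv := measurable_divergence tphi.
have mdivc : measurable_fun
    (Omega° : set (caratheodory_type ((@lebesgue_rV R N)^*)%mu)) (divergence phi).
  apply: measurable_funTS; exact: (measurableT_comp mdiv measurable_idfun_leb).
(* [D] may be replaced by the Borel set [S], as the two differ by a set that is null for the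
   completed measure. *)
rewrite (_ : integral _ _ _ =
    \int[@leb R N]_(x in Omega°) (\1_S x * divergence phi x)%:E)%E; last first.
  apply: ae_eq_integral.
  - exact: sub_lebesgue_measurable.
  - by apply/measurable_EFinP; apply: measurable_funM.
  - apply/measurable_EFinP; apply: measurable_funM => //.
    apply: measurable_funTS; apply: measurable_indic; exact: sub_lebesgue_measurable.
  - exists (D `\` S); split => //.
      by apply: caratheodory_measurable_setD => //; exact: sub_lebesgue_measurable.
    move=> x /=; apply: contra_notP => nDS _; congr (_ * _)%:E.
    rewrite !indicE; congr (nat_of_bool _)%:R; apply/idP/idP; rewrite !inE; last exact: ED.
    by move=> Dx; apply: contrapT => nS; apply: nDS.
rewrite integral_test_field//.
have -> : (\int[lebesgue_rV N]_x (\1_S x * divergence phi x)%:E =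
    \int[lebesgue_rV N]_x ((N%:R * k)%:E * (\1_S x * hat p r (enorm x ^+ N))%:E
      - (N%:R * k)%:E * (\1_S x * hat q r (enorm x ^+ N))%:E))%E.
  apply: eq_integral => x _; rewrite divphi -!EFinM -EFinB /f; congr (_%:E); ring.
rewrite integralB//; last 2 first.
- by apply: integrableZl => //; exact: integrable_hat_radial.
- by apply: integrableZl => //; exact: integrable_hat_radial.
rewrite !integralZl//; [|exact: integrable_hat_radial|exact: integrable_hat_radial].
rewrite !integral_hat_radial//.
have w0 := @unit_ball_volume_ge0 R N.
have Nk0 : 0 <= N%:R * k by rewrite mulr_ge0.
rewrite (_ : _ * (1 - 2 * e) = N%:R * k * (w * ((1 - e) * r ^+ 2)) -
    N%:R * k * (w * (e * r ^+ 2))); last first.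
  by rewrite /k /h; field; rewrite !gt_eqF.
rewrite EFinB !EFinM; apply: leeB.
  by rewrite lee_wpmul2l ?lee_fin// lee_wpmul2l ?lee_fin// -EFinM.
by rewrite lee_wpmul2l ?lee_fin// lee_wpmul2l ?lee_fin// -EFinM.
Qed.

End competitor.
End radial_competitors.

(** Letting the errors tend to 0 bounds the perimeter below by [K], and dividing by the volume
    [w * s] leaves a multiple of (a + s) / s. This is nonincreasing in [s], so the worst case is s =
    (b - a) / 2, where it equals (a + b) / (b - a). *)
Lemma radial_ratio_ge (R : realType) n (l L r0 : R) (D : set 'rV[R]_n.+1) :
  0 <= l -> l < L -> 0 < r0 -> (L ^+ n.+1 + l ^+ n.+1) / 2 <= r0 ^+ n.+1 ->
  radially_symmetric D -> admissible (eball 0 L `\` eball 0 l) D ->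
  ((n.+1%:R * (L ^+ n.+1 + l ^+ n.+1) / ((L ^+ n.+1 - l ^+ n.+1) * r0))%:E <=
    cheeger_ratio (eball 0 L `\` eball 0 l) D)%E.
Proof.
move=> l0 lL r00 r0N sD [mD DO D0 Dle].
set Omega := eball 0 L `\` eball 0 l in DO Dle *.
have w0 := unit_ball_volume_gt0 R n.+1.
have d0 := annulus_width_gt0 n l0 lL.
have lN0 : 0 <= l ^+ n.+1 by exact: exprn_ge0.
rewrite (leb_annulus_half n l0 lL) in Dle.
have Dfin : leb D \is a fin_num.
  by rewrite ge0_fin_numE ?measure_ge0// (le_lt_trans Dle)// ltry.
have [E [mE ED DE]] := @radial_profile R n D Omega L mD (@measurable_annulus R n l L) DO
  (fun x Ox => ltW (andP ((@annulusE R n l L x).1 Ox)).2).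
set S := [set x : 'rV[R]_n.+1 | E (enorm x ^+ n.+1)] in DE.
(* Radial symmetry enters only here: a point with the same norm as a point of [D] is in [D]. *)
have SD : S `<=` D.
  move=> x /ED[y Dy yx]; apply: sD Dy; apply/eqP.
  by rewrite -(@eqrXn2 _ n.+1) ?enorm_ge0//; apply/eqP.
have mS : measurable S by exact: measurable_radial_preimage.
have Eab : E `<=` `[l ^+ n.+1, L ^+ n.+1[.
  move=> _ /ED[x /DO/annulusE/andP[lx xL] <-]; rewrite /= in_itv/=.
  by rewrite ler_pXn2r ?ltr_pXn2r ?nnegrE ?enorm_ge0// ?lx// ltW// (le_lt_trans l0).
have E0 y : E y -> 0 <= y.
  by move=> /Eab; rewrite /= in_itv/= => /andP[+ _]; exact: le_trans.
pose s := fine (leb D) / unit_ball_volume R n.+1.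
have DS : leb D = leb S.
  apply/eqP; rewrite eq_le; apply/andP; split; last exact: le_outer_measure.
  rewrite -(setDUK SD); apply: le_trans (outer_measureU2 _ _ _) _.
  by rewrite [X in (_ + X)%E]DE adde0.
have Es : lebesgue_measure E = s%:E.
  have := lebesgue_rV_radial n mE E0; rewrite -/S -leb_lebesgue_rV// -DS => H.
  have := congr1 (fun z => ((unit_ball_volume R n.+1)^-1%:E * z)%E) H.
  rewrite /= muleA -EFinM mulVf ?gt_eqF// mul1e => <-.
  by rewrite -[in LHS](fineK Dfin) -EFinM mulrC.
have Ds : leb D = (unit_ball_volume R n.+1 * s)%:E.
  by rewrite /s mulrC divfK ?gt_eqF// fineK.
have s0 : 0 < s by move: D0; rewrite Ds lte_fin pmulr_rgt0.
have s_le : s <= (L ^+ n.+1 - l ^+ n.+1) / 2.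
  by move: Dle; rewrite Ds lee_fin -mulrA ler_pM2l.
(* Taking [s' = s * (1 - e)] ties both approximations to a single parameter. *)
have per (e : R) : 0 < e -> e < 1 ->
    ((n.+1%:R * unit_ball_volume R n.+1 *
      ((l ^+ n.+1 + s * (1 - e)) / r0) * (1 - 2 * e))%:E <= perimeter D Omega)%E.
  move=> e0 e1; apply: (@perimeter_radial_ge R n l L l0 lL D E s (s * (1 - e)) e r0) => //.
  - by rewrite mulr_ge0 ?subr_ge0 ?ltW.
  - by rewrite gtr_pMr// ltrBlDr ltrDl.
set K := n.+1%:R * unit_ball_volume R n.+1 * ((l ^+ n.+1 + s) / r0).
have K0 : 0 < K by rewrite !mulr_gt0 ?invr_gt0 ?ltr_wpDl.
have perK : (K%:E <= perimeter D Omega)%E.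
  apply/lee_addgt0Pr => e e0.
  (* Replacing [s'] by [s] costs at most [K * d] and the factor [1 - 2 * d] at most [2 * K * d],
     hence the 3. The bound [1 / 2] keeps [d] below 1, as [per] requires. *)
  pose d := Num.min (1 / 2) (e / (3 * K)).
  have d0' : 0 < d by rewrite lt_min divr_gt0//= divr_gt0// mulr_gt0.
  have d1 : d <= 1 / 2 by rewrite ge_min lexx.
  have K30 : 0 < 3 * K by rewrite mulr_gt0.
  have dK : d * (3 * K) <= e by rewrite -ler_pdivlMr// ge_min lexx orbT.
  have d1' : d < 1 by lra.
  have := per d d0' d1' => /(leeD2r e%:E); apply: le_trans.
  rewrite -EFinD lee_fin.
  have -> : n.+1%:R * unit_ball_volume R n.+1 *
        ((l ^+ n.+1 + s * (1 - d)) / r0) * (1 - 2 * d) =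
      (K - n.+1%:R * unit_ball_volume R n.+1 * (s / r0) * d) * (1 - 2 * d).
    by rewrite /K; field; rewrite gt_eqF.
  set K' := n.+1%:R * _ * (s / r0).
  have K'0 : 0 <= K'.
    by apply: mulr_ge0; [apply: mulr_ge0 => //; exact: ltW|apply: divr_ge0; exact: ltW].
  have K'K : K' <= K.
    by rewrite /K /K' ler_wpM2l ?mulr_ge0 ?(ltW w0)// ler_wpM2r ?invr_ge0 ?(ltW r00)// lerDr.
  nra.
rewrite /cheeger_ratio Ds inver mulf_eq0 !gt_eqF//=.
apply: (@le_trans _ _ (K%:E * (unit_ball_volume R n.+1 * s)^-1%:E)%E); last first.
  by rewrite lee_wpmul2r// lee_fin invr_ge0 mulr_ge0 ?ltW.
rewrite -EFinM lee_fin.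
have -> : K / (unit_ball_volume R n.+1 * s) = n.+1%:R / r0 * ((l ^+ n.+1 + s) / s).
  by rewrite /K; field; rewrite !gt_eqF.
have -> : n.+1%:R * (L ^+ n.+1 + l ^+ n.+1) / ((L ^+ n.+1 - l ^+ n.+1) * r0) =
    n.+1%:R / r0 * ((L ^+ n.+1 + l ^+ n.+1) / (L ^+ n.+1 - l ^+ n.+1)).
  by field; rewrite !gt_eqF.
rewrite ler_wpM2l ?divr_ge0 ?(ltW r00)//.
rewrite ler_pdivrMr// mulrAC ler_pdivlMr//.
(* After expansion the claim is [2 * A * s <= A * (B - A)]. *)
move: (l ^+ n.+1) (L ^+ n.+1) lN0 d0 s_le => A B A0 BA sBA.
nra.
Qed.

(** * Comparison of the two bounds *)

Unset Implicit Arguments.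

Theorem proposition5p11 (R : realType) (N : nat) (l L : R)
    (hN : (2 <= N)%N) (hl : 0 <= l) (hL : l < L) :
  let Omega : set 'rV[R]_N := eball 0 L `\` eball 0 l in
  (h_N Omega < h_rad Omega)%E /\
  (forall omega : set 'rV[R]_N,
     h_N_minimizer Omega omega -> ~ radially_symmetric omega).
Proof.
case: N hN => [//|n] hN Omega.
have L0 : 0 < L by exact: le_lt_trans hL.
have d0 := annulus_width_gt0 n hl hL.
have lN0 : 0 <= l ^+ n.+1 by exact: exprn_ge0.
pose c := (L ^+ n.+1 + l ^+ n.+1) / 2.
have LN0 : 0 < L ^+ n.+1 by exact: exprn_gt0.
have c0 : 0 < c by rewrite divr_gt0// ltr_pwDl.
pose r0 := c `^ (n.+1%:R^-1).
have r00 : 0 < r0 by exact: powR_gt0.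
have r0N : r0 ^+ n.+1 = c.
  by rewrite -powR_mulrn ?ltW// -powRrM mulVf ?pnatr_eq0// powRr1// ltW.
have r0L : r0 < L.
  rewrite -(@ltr_pXn2r _ n.+1) ?nnegrE ?ltW// r0N /c.
  by move: (l ^+ n.+1) (L ^+ n.+1) d0 => A B; lra.
have lt_rad : (h_N Omega < h_rad Omega)%E.
  apply: le_lt_trans (h_N_annulus_le n hl hL) _.
  apply: (@lt_le_trans _ _
    (n.+1%:R * (L ^+ n.+1 + l ^+ n.+1) / ((L ^+ n.+1 - l ^+ n.+1) * r0))%:E).
    rewrite lte_fin [ltRHS](_ : _ =
        n.+1%:R * (L ^+ n.+1 + l ^+ n.+1) / r0 / (L ^+ n.+1 - l ^+ n.+1)).
      (* Without the common factors this is [L ^+ n * r0 < L ^+ n.+1 + l ^+ n.+1]; strictness comes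
         from [r0 < L]. *)
      rewrite ltr_pM2r ?invr_gt0// ltr_pdivlMr// -mulrA ltr_pM2l//.
      by rewrite (@lt_le_trans _ _ (L ^+ n.+1)) ?lerDl// exprSr ltr_pM2l ?exprn_gt0.
    by field; rewrite !gt_eqF.
  apply: le_ereal_inf_tmp => _ [D [sD aD] <-].
  by apply: radial_ratio_ge => //; rewrite r0N.
(* A radial minimizer of [h_N] would compete in [h_rad] and force [h_rad Omega <= h_N Omega]. *)
split=> // omega [aom omE] som; move: lt_rad; rewrite ltNge => /negP; apply.
by rewrite -omE; apply: ereal_inf_lbound; exists omega.
Qed.
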